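(* Let $X\sim ID(b,0,\nu)$ be nondegenerate, self-decomposable and such that $\mathbb{E}|X|<\infty$. Let $h:\mathbb{R}\to\mathbb{R}$ belong to $C_c^\infty(\mathbb{R})$ with $\|h\|_\infty\le1$, $\|h'\|_\infty\le1$ and $\|h''\|_\infty\le1$. Let $$f_h(x)=-\int_0^{+\infty}\big(P_t^\nu(h)(x)-\mathbb{E}h(X)\big)\,dt,\qquad x\in\mathbb{R}.$$ Then, for all $x\in\mathbb{R}$, $$(\mathbb{E}X-x)f_h'(x)+\int_{-\infty}^{+\infty}\big(f_h'(x+u)-f_h'(x)\big)\,u\,\nu(du)=h(x)-\mathbb{E}h(X).$$
   Context: A Lévy measure is a positive Borel measure $\nu$ on $\mathbb{R}$ with $\nu(\{0\})=0$ and $\int(1\wedge u^2)\nu(du)<\infty$. $X\sim ID(b,0,\nu)$ means that $\nu$ is a Lévy measure and $\varphi(t)=\mathbb{E}e^{itX}=\exp\big(itb+\int(e^{itu}-1-itu\mathbf{1}_{|u|\le1})\nu(du)\big)$ for all $t\in\mathbb{R}$. $X$ is self-decomposable if for every $\gamma\in(0,1)$, $t\mapsto\varphi(t)/\varphi(\gamma t)$ is a characteristic function. For $t\ge0$ and $f$ in the Schwartz space $\mathcal{S}(\mathbb{R})$, $P_t^\nu(f)(x)=\frac{1}{2\pi}\int_{-\infty}^{+\infty}\mathcal{F}(f)(\xi)e^{i\xi xe^{-t}}\frac{\varphi(\xi)}{\varphi(e^{-t}\xi)}d\xi$, with $\mathcal{F}(f)(\xi)=\int f(x)e^{-ix\xi}dx$;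 equivalently $P_t^\nu(f)(x)=\int f(y+e^{-t}x)\mu_t(dy)$, where $\mu_t$ is the probability measure with characteristic function $\xi\mapsto\varphi(\xi)/\varphi(e^{-t}\xi)$. The integral defining $f_h$ converges absolutely and $f_h$ is differentiable. $C_c^\infty(\mathbb{R})$ is the space of infinitely differentiable compactly supported functions. *)

(* Defs.v *)
From HB Require Import structures.
From mathcomp Require Import all_boot all_order all_algebra.
From mathcomp Require Import all_classical all_reals all_analysis.
From mathcomp Require Import complex.

Set Implicit Arguments.
Unset Strict Implicit.
Unset Printing Implicit Defensive.

Import Order.TTheory GRing.Theory Num.Theory.
Import numFieldNormedType.Exports.

Local Open Scope classical_set_scope.
Local Open Scope ring_scope.
Local Open Scope complex_scope.

Definition cexp {R : realType} (z : R[i]) : R[i] :=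
  (expR (complex.Re z) * cos (complex.Im z)) +i* (expR (complex.Re z) * sin (complex.Im z)).

(* Integral over the whole space of a complex-valued function. *)
Definition cintegral {R : realType} {d : measure_display}
    {T : measurableType d} (mu : {measure set T -> \bar R})
    (f : T -> R[i]) : R[i] :=
  (\int[mu]_w complex.Re (f w)) +i* (\int[mu]_w complex.Im (f w)).

Definition char_fun {R : realType} {d : measure_display}
    {T : measurableType d} (P : probability T R) (X : {RV P >-> R})
    (t : R) : R[i] :=
  cintegral P (fun w => cexp ((t * X w) *i)).

Definition is_char_fun {R : realType} (psi : R -> R[i]) : Prop :=
  exists mu : probability (measurableTypeR R) R,
    forall t : R, psi t = cintegral mu (fun x => cexp ((t * x) *i)).

Definition self_decomposable {R : realType} {d : measure_display}
    {T : measurableType d} (P : probability T R) (X : {RV P >-> R}) : Prop :=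
  forall c : R, 0 < c -> c < 1 ->
    is_char_fun (fun t => char_fun X t / char_fun X (c * t)).

Definition levy_measure {R : realType}
    (nu : {measure set (measurableTypeR R) -> \bar R}) : Prop :=
  nu [set 0] = 0%E /\
  (\int[nu]_u (Num.min 1 (u ^+ 2))%:E < +oo)%E.

(* X ~ ID(b, 0, nu), given by the Levy-Khintchine formula with truncation
   function u |-> u 1_{|u| <= 1}. *)
Definition ID {R : realType} {d : measure_display}
    {T : measurableType d} (P : probability T R) (X : {RV P >-> R})
    (b : R) (nu : {measure set (measurableTypeR R) -> \bar R}) : Prop :=
  levy_measure nu /\
  forall t : R,
    char_fun X t =
    cexp ((t * b) *i +
          cintegral nu (fun u : R =>
            cexp ((t * u) *i) - 1 -
            (t * u * \1_[set v : R | `|v| <= 1] u) *i)).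

Definition nondegenerate_rv {R : realType} {d : measure_display}
    {T : measurableType d} (P : probability T R) (X : {RV P >-> R}) : Prop :=
  ~ exists c : R, {ae P, forall w, X w = c}.

Definition fourier {R : realType} (f : R -> R[i]) (xi : R) : R[i] :=
  cintegral lebesgue_measure (fun x : R => f x * cexp ((- (x * xi)) *i)).

Definition semigroup {R : realType} (phi : R -> R[i]) (t : R)
    (f : R -> R[i]) (x : R) : R[i] :=
  ((2 * pi)^-1)%:C *
  cintegral lebesgue_measure (fun xi : R =>
    fourier f xi * cexp ((xi * x * expR (- t)) *i) *
    (phi xi / phi (expR (- t) * xi))).

(* For real-valued h the complex number semigroup phi t h x is real, because
   phi (- xi) is the conjugate of phi xi; Re only changes its type. *)
Definition stein_solution {R : realType} {d : measure_display}
    {T : measurableType d} (P : probability T R) (X : {RV P >-> R})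
    (h : R -> R) (x : R) : R :=
  - \int[lebesgue_measure]_(t in `[0, +oo[)
      (complex.Re (semigroup (char_fun X) t (fun y => (h y)%:C) x)
       - \int[P]_w h (X w)).

Definition smooth_compact_support {R : realType} (h : R -> R) : Prop :=
  (forall (n : nat) (x : R), derivable (derive1n n h) x 1) /\
  compact (closure [set x : R | h x != 0]).

(* Main.v *)
(* Write phi = exp (- psi + i theta) for the characteristic function of X and
   cosT h, sinT h for the cosine and sine transforms of h.  For c = e^(-t),
   Fourier inversion turns 2 pi P_t h(x) into the integral over xi of
     Gamma c = exp (psi (c xi) - psi xi) (cosT h xi cos w + sinT h xi sin w),
     w = c xi x + theta xi - theta (c xi),
   and 2 pi E h(X) into the integral of Gamma 0.  Hence f_h is, up to the factor
   - 1 / (2 pi), the integral of Gamma (e^(-t)) - Gamma 0 over (t, xi), and may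
   be differentiated under the integral.  Since E X = theta' 0,
   theta' s - theta' 0 = int u (cos (s u) - 1) nu(du) and
   psi' s = int u sin (s u) nu(du), applying the Stein operator under the
   integral produces the t-derivative of Gamma (e^(-t)), which integrates to
   Gamma 0 - Gamma 1, i.e. to 2 pi (E h(X) - h x).

   Two inputs make the integrals converge.  Self-decomposability gives
   |phi xi / phi (c xi)| <= 1, that is psi (c xi) <= psi xi.  The first moment of
   X gives int min (|u|, u^2) nu(du) < oo, because 1 - Re phi dominates psi near
   0 and sum_k 2^k (1 - cos (y / 2^k)) is comparable to |y| for |y| >= 1 and
   bounded by 12 |y| for all y. *)
Require Import Defs.
From HB Require Import structures.
From mathcomp Require Import all_boot all_order all_algebra.
From mathcomp Require Import all_classical all_reals all_analysis.
From mathcomp Require Import measurable_realfun.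
From mathcomp Require Import complex ring lra.
Set Implicit Arguments.
Unset Strict Implicit.
Unset Printing Implicit Defensive.
Import Order.TTheory GRing.Theory Num.Theory.
Import numFieldNormedType.Exports.
Local Open Scope classical_set_scope.
Local Open Scope ring_scope.

(** The bounds on [dpsi] and [dtheta] obtained from the first moment are linear in the frequency, so
    the derivative of Gamma in c is controlled only to order xi^2. Four derivatives of [h] make its
    transforms of order (1 + xi^2)^-2 and leave the integrable weight (1 + xi^2)^-1. The decay in
    time does not come from convergence of the semigroup to equilibrium: it is the length of the
    interval [0, e^(-t)] on which Gamma is compared with Gamma 0. Every integrand is thus dominated
    by a product of functions of single variables, built from e^(-t), (1 + xi^2)^-1 and min (|u|,
    u^2), and every exchange of integrals is Fubini under a product bound. With [nu] as a factor
    this calls for sigma-finiteness, which is derived from the Levy condition. No logarithm of phi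
    has to be chosen: psi and theta are explicit integrals against [nu], and phi has no zero because
    it is an exponential. *)

(** * Integration of real-valued functions *)

Section real_integral.
Context d (T : measurableType d) (R : realType).
Variable mu : {measure set T -> \bar R}.
Implicit Types f g : T -> R.
Local Notation L1 f := (mu.-integrable [set: T] (EFin \o f)).

Lemma measurable_L1 f : L1 f -> measurable_fun [set: T] f.
Proof. by move=> /measurable_int/measurable_EFinP. Qed.

Lemma L1_le f g : measurable_fun [set: T] f -> (forall x, `|f x| <= g x) ->
  L1 g -> L1 f.
Proof.
move=> mf fg; apply: le_integrable => //; first exact/measurable_EFinP.
by move=> x _ /=; rewrite lee_fin (le_trans (fg x))// ler_norm.
Qed.

Lemma L1_norm f : L1 f -> L1 (fun x => `|f x|).
Proof. exact: integrable_norm. Qed.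

Lemma L1D f g : L1 f -> L1 g -> L1 (fun x => f x + g x).
Proof. by move=> i j; apply: integrableD i j. Qed.

Lemma L1B f g : L1 f -> L1 g -> L1 (fun x => f x - g x).
Proof. by move=> i j; apply: integrableB i j. Qed.

Lemma L1Zl k f : L1 f -> L1 (fun x => k * f x).
Proof. exact: integrableZl. Qed.

Lemma normr_Rintegral_le f g :
  (forall x, `|f x| <= g x) -> L1 f -> L1 g ->
  `|\int[mu]_x f x| <= \int[mu]_x g x.
Proof.
move=> fg if_ ig; apply: le_trans (le_normr_Rintegral _ _) _ => //.
by apply: le_Rintegral => //; exact: L1_norm.
Qed.

Lemma Rdominated_cvg (f_ : nat -> T -> R) f g :
  (forall n, measurable_fun [set: T] (f_ n)) ->
  (forall x, f_ n x @[n --> \oo] --> f x) ->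
  (forall n x, `|f_ n x| <= g x) -> L1 g ->
  \int[mu]_x f_ n x @[n --> \oo] --> \int[mu]_x f x.
Proof.
move=> mf_ cf fg ig.
have mf : measurable_fun [set: T] f.
  by apply: (measurable_fun_cvg mf_) => x _; exact: cf.
have fleg x : `|f x| <= g x.
  have cn : `|f_ n x| @[n --> \oo] --> `|f x| by apply: cvg_norm; exact: cf.
  rewrite -(cvg_lim _ cn)//; apply: limr_le; first by apply/cvg_ex; exists `|f x|.
  by apply: nearW => n; exact: fg.
have c_ : {ae mu, forall x, [set: T] x ->
    (fun n => (EFin \o f_ n) x) @ \oo --> (EFin \o f) x}.
  by apply: aeW => x _; apply: cvg_EFin; [exact: nearW|exact: cf].
have mE n : measurable_fun [set: T] (EFin \o f_ n) by exact/measurable_EFinP.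
have mE' : measurable_fun [set: T] (EFin \o f) by exact/measurable_EFinP.
have g_ : {ae mu, forall x n, [set: T] x ->
    (`|(EFin \o f_ n) x| <= (EFin \o g) x)%E}.
  by apply: aeW => x n _ /=; rewrite lee_fin.
have [i_ _ h] := dominated_convergence measurableT mE mE' c_ ig g_.
by apply: fine_cvg; rewrite fineK//; exact: integrable_fin_num.
Qed.

(** The dominating function may depend on the radius [M]: the bounds for [dpsi] and [dtheta] carry a
    factor that grows with the frequency, so the domination is local. The ball of radius [|a| + 1]
    is a neighbourhood of [a]. *)
Lemma continuous_Rintegral (f : R -> T -> R) :
  (forall x, L1 (f x)) -> (forall y, continuous (f ^~ y)) ->
  (forall M : R, exists2 G : T -> R, L1 G &
    forall x y, `|x| < M -> `|f x y| <= G y) ->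
  continuous (fun x => \int[mu]_y f x y).
Proof.
move=> if_ cf fG a; have [G iG fleG] := fG (`|a| + 1).
have Ia : a \in `](- (`|a| + 1)), (`|a| + 1)[.
  by rewrite in_itv/= -ltr_norml ltrDl.
apply: (@continuity_under_integral R _ T mu f setT measurableT
   (- (`|a| + 1)) (`|a| + 1) _ _ G) => //.
- by apply: aeW => y _ x _; exact: cf.
- move=> x; rewrite /= in_itv/= -ltr_norml => xM.
  by apply: aeW => y _; exact: fleG.
- exact/mem_set.
Qed.

Lemma is_derive_Rintegral (f df : R -> T -> R) :
  (forall x, L1 (f x)) -> (forall (x : R) y, is_derive x (1 : R) (f ^~ y) (df x y)) ->
  (forall M : R, exists2 G : T -> R, L1 G &
    forall x y, `|x| < M -> `|df x y| <= G y) ->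
  forall x : R, is_derive x (1 : R) (fun x => \int[mu]_y f x y) (\int[mu]_y df x y).
Proof.
move=> if_ dfE fG a; have [G iG fleG] := fG (`|a| + 1).
have Ia : `](- (`|a| + 1)), (`|a| + 1)[%classic a.
  by rewrite /= in_itv/= -ltr_norml ltrDl.
have pE x y : partial1of2 f x y = df x y.
  by rewrite partial1of2E; have := dfE x y; case.
have G0 y : 0 <= G y.
  by rewrite (le_trans _ (fleG a y _))// ltrDl.
have d1 x y : derivable (f ^~ y) x 1 by have := dfE x y; case.
have ub x y : `](- (`|a| + 1)), (`|a| + 1)[%classic x -> [set: T] y ->
    `|partial1of2 f x y| <= G y.
  by rewrite /= in_itv/= -ltr_norml pE => xM _; exact: fleG.
apply: DeriveDef.
- by apply: (@derivable_under_integral R _ T mu f setT measurableT a _ _ Ia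
    _ _ G G0 iG ub) => // *; exact: if_.
- rewrite -derive1E (@differentiation_under_integral R _ T mu f setT
    measurableT a _ _ Ia _ _ G G0 iG ub) => // *; try exact: if_.
  by apply: eq_Rintegral => y _; exact: pE.
Qed.

End real_integral.

(** * Fubini for real-valued integrands under a product bound *)

Section real_fubini.
Context d1 d2 (T1 : measurableType d1) (T2 : measurableType d2) (R : realType).
Variables (m1 : {sigma_finite_measure set T1 -> \bar R})
  (m2 : {sigma_finite_measure set T2 -> \bar R}).
Variables (f : T1 * T2 -> R) (g1 : T1 -> R) (g2 : T2 -> R).
Hypothesis mf : measurable_fun [set: T1 * T2] f.
Hypothesis ig1 : m1.-integrable [set: T1] (EFin \o g1).
Hypothesis ig2 : m2.-integrable [set: T2] (EFin \o g2).
Hypothesis fg : forall x y, `|f (x, y)| <= g1 x * g2 y.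

Lemma L1_prod : (m1 \x m2)%E.-integrable [set: T1 * T2] (EFin \o f).
Proof.
apply: (@L1_le _ _ _ _ f (fun z => `|g1 z.1| * `|g2 z.2|)) => //.
  by case=> x y /=; rewrite (le_trans (fg x y))// -normrM ler_norm.
have mg : measurable_fun [set: T1 * T2] (fun z => `|g1 z.1| * `|g2 z.2|).
  apply: measurable_funM; apply: measurableT_comp => //.
  - by apply: measurableT_comp => //; exact: (measurable_L1 ig1).
  - by apply: measurableT_comp => //; exact: (measurable_L1 ig2).
apply/integrable12ltyP; first exact/measurable_EFinP.
have e x y : (`|(EFin \o (fun z : T1 * T2 => (`|g1 z.1| * `|g2 z.2|)%R)) (x, y)|
    = (`|g1 x|)%:E * `|g2 y|%:E)%E.
  by rewrite /= normrM !normr_id.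
under eq_integral => x _ do under eq_integral => y _ do rewrite e.
have m2g : measurable_fun [set: T2] (fun y => `|g2 y|).
  by apply: measurableT_comp => //; exact: (measurable_L1 ig2).
have m1g : measurable_fun [set: T1] (fun y => `|g1 y|).
  by apply: measurableT_comp => //; exact: (measurable_L1 ig1).
have e2 x : (\int[m2]_y (`|g1 x|%:E * `|g2 y|%:E)
    = `|g1 x|%:E * \int[m2]_y `|g2 y|%:E)%E.
  by rewrite ge0_integralZl//; exact/measurable_EFinP.
under eq_integral => x _ do rewrite e2.
rewrite ge0_integralZr//; last 2 first.
- exact/measurable_EFinP.
- by apply: integral_ge0.
have /integrableP[_ i1] := ig1; have /integrableP[_ i2] := ig2.
apply: lte_mul_pinfty; [exact: integral_ge0| |exact: i2].
by rewrite ge0_fin_numE; [exact: i1|exact: integral_ge0].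
Qed.

(** A product bound makes every section integrable, not just almost every one. Inner real and
    extended integrals then agree at every point ([E1], [E2]), with no exceptional null set to carry
    along. *)
Lemma L1_sect1 x : m2.-integrable [set: T2] (EFin \o (fun y => f (x, y))).
Proof.
apply: (@L1_le _ _ _ _ _ (fun y => g1 x * g2 y)) => //.
  exact: measurableT_comp.
exact: L1Zl.
Qed.

Lemma L1_sect2 y : m1.-integrable [set: T1] (EFin \o (fun x => f (x, y))).
Proof.
apply: (@L1_le _ _ _ _ _ (fun x => g2 y * g1 x)) => //.
- exact: measurableT_comp.
- by move=> x; rewrite mulrC.
- exact: L1Zl.
Qed.

Let E1 x : (\int[m2]_y f (x, y))%:E = (\int[m2]_y (f (x, y))%:E)%E.
Proof. by rewrite fineK//; apply: integrable_fin_num => //; exact: L1_sect1. Qed.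

Let E2 y : (\int[m1]_x f (x, y))%:E = (\int[m1]_x (f (x, y))%:E)%E.
Proof. by rewrite fineK//; apply: integrable_fin_num => //; exact: L1_sect2. Qed.

Lemma L1_Rintegral1 :
  m1.-integrable [set: T1] (EFin \o (fun x => \int[m2]_y f (x, y))).
Proof.
rewrite (_ : _ \o _ = fubini_F m2 (EFin \o f)); last exact/funext.
exact/integrable_fubini_F/L1_prod.
Qed.

Lemma L1_Rintegral2 :
  m2.-integrable [set: T2] (EFin \o (fun y => \int[m1]_x f (x, y))).
Proof.
apply: (@L1_le _ _ _ _ _ (fun y => (\int[m1]_x `|g1 x|) * `|g2 y|)).
- apply/measurable_EFinP.
  rewrite (_ : _ \o _ = fubini_G m1 (EFin \o f)); last exact/funext.
  exact/measurable_fubini_G/L1_prod.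
- move=> y; rewrite -RintegralZr//; last exact: L1_norm.
  apply: normr_Rintegral_le.
  + by move=> x; rewrite (le_trans (fg _ _))// -normrM ler_norm.
  + exact: L1_sect2.
  + by under eq_fun do rewrite mulrC; apply: L1Zl; exact: L1_norm.
- by apply: L1Zl; exact: L1_norm.
Qed.

Lemma Rintegral12 :
  \int[m1]_x \int[m2]_y f (x, y) = \int[(m1 \x m2)%E]_z f z.
Proof.
rewrite /Rintegral -integral12_prod_meas1; last exact: L1_prod.
by congr fine; apply: eq_integral => x _; exact: E1.
Qed.

Lemma Rintegral21 :
  \int[m2]_y \int[m1]_x f (x, y) = \int[(m1 \x m2)%E]_z f z.
Proof.
rewrite /Rintegral -integral21_prod_meas1; last exact: L1_prod.
by congr fine; apply: eq_integral => x _; exact: E2.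
Qed.

Lemma RFubini :
  \int[m1]_x \int[m2]_y f (x, y) = \int[m2]_y \int[m1]_x f (x, y).
Proof. by rewrite Rintegral12 Rintegral21. Qed.

End real_fubini.

Lemma measurable_compR d (T : measurableType d) (R : realType) (f : R -> R)
  (g : T -> R) : measurable_fun [set: R] f -> measurable_fun [set: T] g ->
  measurable_fun [set: T] (fun z => f (g z)).
Proof. by move=> mf mg; apply: (measurableT_comp mf mg). Qed.

Lemma measurable_compC d (T : measurableType d) (R : realType) (f : R -> R)
  (g : T -> R) : continuous f -> measurable_fun [set: T] g ->
  measurable_fun [set: T] (fun z => f (g z)).
Proof.
by move=> cf; apply: measurable_compR; exact: continuous_measurable_fun.
Qed.

Lemma L1_sum d (T : measurableType d) (R : realType)
  (mu : {measure set T -> \bar R}) (f : nat -> T -> R) n :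
  (forall k, mu.-integrable [set: T] (EFin \o f k)) ->
  mu.-integrable [set: T] (EFin \o (fun x => \sum_(k < n) f k x)) /\
  \int[mu]_x (\sum_(k < n) f k x) = \sum_(k < n) \int[mu]_x f k x.
Proof.
move=> fi; elim: n => [|n [IH1 IH2]].
  have -> : (fun x => \sum_(k < 0) f k x) = cst 0.
    by apply/funext => x; rewrite big_ord0.
  by rewrite /Rintegral integral0 big_ord0; split => //; exact: integrable0.
have -> : (fun x => \sum_(k < n.+1) f k x) = (fun x => \sum_(k < n) f k x + f n x).
  by apply/funext => x; rewrite big_ord_recr.
by rewrite big_ord_recr/= -IH2 RintegralD//; split => //; exact: L1D.
Qed.

(* [nu] itself, retyped so that the sigma-finiteness hypothesis can be attached
   to it as a structure. *)
Definition sigma_finite_copy d (T : measurableType d) (R : realType)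
  (nu : {measure set T -> \bar R}) of sigma_finite [set: T] nu :
  set T -> \bar R := nu.

Section sigma_finite_copy.
Context d (T : measurableType d) (R : realType).
Variables (nu : {measure set T -> \bar R}) (nu_sf : sigma_finite [set: T] nu).

HB.instance Definition _ := isMeasure.Build _ _ _ (sigma_finite_copy nu_sf)
  (measure0 nu) (measure_ge0 nu) (@measure_semi_sigma_additive _ _ _ nu).

HB.instance Definition _ := Measure_isSigmaFinite.Build _ _ _
  (sigma_finite_copy nu_sf) nu_sf.

End sigma_finite_copy.

(** Needed because the product of the time and frequency measures becomes itself a factor of a
    product with [nu]. Both exhaustions are nondecreasing, so the diagonal rectangles already
    cover. *)
Lemma product_sigma_finite d1 d2 (T1 : measurableType d1)
  (T2 : measurableType d2) (R : realType)
  (m1 : {sigma_finite_measure set T1 -> \bar R})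
  (m2 : {sigma_finite_measure set T2 -> \bar R}) :
  sigma_finite [set: T1 * T2] (m1 \x m2)%E.
Proof.
have /sigma_finiteP[F [UF ndF finF]] := sigma_finiteT m1.
have /sigma_finiteP[G [UG ndG finG]] := sigma_finiteT m2.
exists (fun n => F n `*` G n); last first.
  move=> n; have [mFn Fn] := finF n; have [mGn Gn] := finG n.
  split; first exact: measurableX.
  by rewrite product_measure1E//; apply: lte_mul_pinfty; rewrite ?ge0_fin_numE.
apply/seteqP; split => // -[x y] _.
have [i _ Fix] : (\bigcup_n F n) x by rewrite -UF.
have [j _ Gjy] : (\bigcup_n G n) y by rewrite -UG.
exists (maxn i j) => //; split => /=.
  by move/subsetPset: (ndF _ _ (leq_maxl i j)); exact.
by move/subsetPset: (ndG _ _ (leq_maxr i j)); exact.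
Qed.

(** * Elementary estimates and the half line *)

Section elementary.
Context {R : realType}.
Implicit Types (f g F G : R -> R) (a b x y v : R).

Lemma MVT_norm_le f df a b K : a <= b ->
  (forall x, is_derive x (1 : R) f (df x)) ->
  (forall x, a <= x <= b -> `|df x| <= K) -> `|f b - f a| <= K * (b - a).
Proof.
move=> ab fE dfK.
have [|c cab ->] := @MVT_segment R f df a b ab (fun x _ => fE x).
  apply: continuous_subspaceT => x.
  by have [d _] := fE x; exact/differentiable_continuous/derivable1_diffP.
by rewrite normrM (@ger0_norm _ (b - a)) ?subr_ge0// ler_wpM2r ?subr_ge0// dfK.
Qed.

Lemma MVT_norm_le0 f df x K :
  (forall x, is_derive x (1 : R) f (df x)) ->
  (forall y, `|y| <= `|x| -> `|df y| <= K) -> `|f x - f 0| <= K * `|x|.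
Proof.
move=> fE dfK; have [x0|x0] := leP 0 x.
  rewrite (ger0_norm x0) -[X in _ * X]subr0; apply: MVT_norm_le fE _ => //.
  by move=> y /andP[y0 yx]; apply: dfK; rewrite !ger0_norm.
rewrite (ltr0_norm x0) distrC -[X in _ * X]add0r; apply: MVT_norm_le fE _.
  exact: ltW.
by move=> y /andP[y0 yx]; apply: dfK; rewrite !ler0_norm ?lerN2// ltW.
Qed.

Lemma norm_sin_le v : `|sin v| <= `|v|.
Proof.
have := @MVT_norm_le0 sin cos v 1 (@is_derive_sin R) (fun y _ => cos_max y).
by rewrite sin0 subr0 mul1r.
Qed.

Lemma onemcos_ge0 v : 0 <= 1 - cos v.
Proof. by rewrite subr_ge0 cos_le1. Qed.

(** The constant is 1 rather than the optimal 1/2, because the derivative is bounded by its maximum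
    [|v|] on the whole segment. *)
Lemma onemcos_le v : 1 - cos v <= v ^+ 2.
Proof.
have : `|cos v - cos 0| <= `|v| * `|v|.
  apply: (@MVT_norm_le0 cos (fun x => - sin x)) => y yv.
  by rewrite normrN (le_trans (norm_sin_le _)).
by rewrite cos0 -normrM -expr2 distrC (ger0_norm (onemcos_ge0 v))
  (ger0_norm (sqr_ge0 v)).
Qed.

Lemma norm_cosB1_le v : `|cos v - 1| <= `|v|.
Proof.
rewrite -[`|v|]mul1r -[X in _ - X]cos0.
apply: (@MVT_norm_le0 cos (fun x => - sin x)) => y yv.
by rewrite normrN sin_max.
Qed.

Lemma norm_sinB_le v : `|sin v - v| <= v ^+ 2.
Proof.
have d x : is_derive x (1 : R) (fun z => sin z - z) (cos x - 1).
  exact: is_deriveB.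
have : `|(sin v - v) - (sin 0 - 0)| <= `|v| * `|v|.
  apply: (@MVT_norm_le0 (fun z => sin z - z) (fun x => cos x - 1)) => y yv.
  by rewrite (le_trans (norm_cosB1_le _)).
by rewrite sin0 !subr0 -normrM -expr2 (ger0_norm (sqr_ge0 v)).
Qed.

Lemma onemcos_le2 v : 1 - cos v <= 2.
Proof. by have := cos_geN1 v; lra. Qed.

(* The right-hand side telescopes when summed with weights 2^k over v / 2^k. *)
Lemma onemcos_telescope v :
  1 - cos v <= 12 * v ^+ 2 / (1 + `|v|)
               - 2 * (12 * (v / 2) ^+ 2 / (1 + `|v / 2|)).
Proof.
have v0 := normr_ge0 v.
have -> : `|v / 2| = `|v| / 2 by rewrite normrM (@ger0_norm _ 2^-1) ?invr_ge0.
have -> : 12 * v ^+ 2 / (1 + `|v|) - 2 * (12 * (v / 2) ^+ 2 / (1 + `|v| / 2))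
    = 12 * v ^+ 2 / ((1 + `|v|) * (2 + `|v|)).
  by field; rewrite !lt0r_neq0 //; lra.
rewrite ler_pdivlMr; last by apply: mulr_gt0; lra.
rewrite -(real_normK (num_real v)).
have c0 := onemcos_ge0 v; have c2 := onemcos_le2 v; have := onemcos_le v.
rewrite -(real_normK (num_real v)) => cv.
(* The constant 12 is the value of (1 + |v|)(2 + |v|) at |v| = 2. Up to there [1 - cos v <= v^2]
   suffices; beyond, [1 - cos v <= 2] and (1 + |v|)(2 + |v|) <= 6 v^2. *)
have [v2|v2] := leP `|v| 2.
  apply: (@le_trans _ _ (`|v| ^+ 2 * 12)); last lra.
  by apply: ler_pM => //; nra.
apply: (@le_trans _ _ (2 * (6 * `|v| ^+ 2))); last lra.
by apply: ler_pM => //; nra.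
Qed.

End elementary.

Section half_line.
Context {R : realType}.
Local Notation mu := (@lebesgue_measure R).
Implicit Types (f g F G : R -> R).

Lemma is_derive_continuous F f : (forall x, is_derive x (1 : R) F (f x)) ->
  continuous F.
Proof.
move=> FE x; have [d _] := FE x.
exact/differentiable_continuous/derivable1_diffP.
Qed.

Lemma ge0_FTC2y g G (a l : R) : continuous g -> (forall x, a <= x -> 0 <= g x) ->
  (forall x, is_derive x (1 : R) G (g x)) -> G x @[x --> +oo] --> l ->
  (\int[mu]_(x in `[a, +oo[) (g x)%:E = l%:E - (G a)%:E)%E.
Proof.
move=> cg g0 GE Gl; apply: ge0_continuous_FTC2y.
- exact: g0.
- exact: continuous_subspaceT.
- exact: Gl.
- by move=> x _; have [] := GE x.
- by apply: cvg_at_right_filter; exact: (is_derive_continuous GE).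
- by move=> x _; rewrite derive1E; have [] := GE x.
Qed.

(** Reduction to nonnegative integrands: [f + g] and [g] are both nonnegative on the half line and
    have primitives with limits, and the formula for [f] is the difference of theirs. The same
    device, adding a dominating function and subtracting it, gives [even_integral] and
    [Rintegral_affine]. *)
Lemma dominated_FTC2y f g F G (a lF lG : R) :
  continuous f -> continuous g -> (forall x, a <= x -> `|f x| <= g x) ->
  (forall x, is_derive x (1 : R) F (f x)) ->
  (forall x, is_derive x (1 : R) G (g x)) ->
  F x @[x --> +oo] --> lF -> G x @[x --> +oo] --> lG ->
  mu.-integrable `[a, +oo[ (EFin \o f) /\
  \int[mu]_(x in `[a, +oo[) f x = lF - F a.
Proof.
move=> cf cg fg FE GE Fl Gl.
have g0 x : a <= x -> 0 <= g x by move=> ax; rewrite (le_trans _ (fg x ax)).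
have mT (h : R -> R) : continuous h -> measurable_fun `[a, +oo[ h.
  by move=> ch; apply: measurable_funTS; exact: continuous_measurable_fun.
have Ig := ge0_FTC2y cg g0 GE Gl.
have fg0 x : a <= x -> 0 <= f x + g x.
  by move=> /fg; rewrite ler_norml => /andP[? _]; lra.
have cfg : continuous (fun x => f x + g x).
  by move=> x; apply: continuousD; [exact: cf|exact: cg].
have Ifg := ge0_FTC2y cfg fg0 (fun x => is_deriveD (FE x) (GE x)) (cvgD Fl Gl).
have ig : mu.-integrable `[a, +oo[ (EFin \o g).
  apply/integrableP; split; first by apply/measurable_EFinP; exact: mT.
  have -> : (\int[mu]_(x in `[a, +oo[) `|(EFin \o g) x| =
      \int[mu]_(x in `[a, +oo[) (g x)%:E)%E.
    apply: eq_integral => x; rewrite inE/= in_itv/= andbT => ax.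
    by rewrite ger0_norm// g0.
  by rewrite Ig -EFinB ltry.
have if_ : mu.-integrable `[a, +oo[ (EFin \o f).
  apply: le_integrable ig => //; first by apply/measurable_EFinP; exact: mT.
  move=> x; rewrite /= in_itv/= andbT => ax; rewrite lee_fin.
  by rewrite (ger0_norm (g0 x ax)) fg.
split => //.
have : \int[mu]_(x in `[a, +oo[) (f x + g x) =
    \int[mu]_(x in `[a, +oo[) f x + \int[mu]_(x in `[a, +oo[) g x.
  by rewrite RintegralD.
have -> : \int[mu]_(x in `[a, +oo[) g x = lG - G a by rewrite /Rintegral Ig.
rewrite /Rintegral Ifg -!EFinB /= (_ : (F + G) a = F a + G a)//; lra.
Qed.

Lemma even_integral f g : continuous f -> continuous g ->
  (forall x, `|f x| <= g x) -> (forall x, f (- x) = f x) ->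
  (forall x, g (- x) = g x) -> mu.-integrable `[0, +oo[ (EFin \o g) ->
  mu.-integrable [set: R] (EFin \o f) /\
  \int[mu]_x f x = 2 * \int[mu]_(x in `[0, +oo[) f x.
Proof.
move=> cf cg fg ef eg ig.
have g0 x : 0 <= g x by rewrite (le_trans _ (fg x)).
have fg0 x : 0 <= f x + g x.
  by have := fg x; rewrite ler_norml => /andP[? _]; lra.
have cfg : continuous (fun x => f x + g x).
  by move=> x; apply: continuousD; [exact: cf|exact: cg].
have S (h : R -> R) : (forall x, 0 <= h x) -> continuous h -> (forall x, h (- x) = h x) ->
    (\int[mu]_x (h x)%:E = 2%:E * \int[mu]_(x in `[0%R, +oo[) (h x)%:E)%E.
  move=> h0 ch eh; rewrite ge0_symfun_integralT//; last by move=> x; rewrite /= eh.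
  by congr (_ * integral _ _ _)%E; apply/seteqP; split => x /=; rewrite in_itv/= andbT.
have if0 : mu.-integrable `[0, +oo[ (EFin \o f).
  apply: le_integrable ig => //.
    by apply/measurable_EFinP/measurable_funTS; exact: continuous_measurable_fun.
  by move=> x _ /=; rewrite lee_fin (ger0_norm (g0 x)).
have igT : mu.-integrable [set: R] (EFin \o g).
  apply/integrableP; split; first by apply/measurable_EFinP; exact: continuous_measurable_fun.
  under eq_integral => x _ do rewrite /= (ger0_norm (g0 x)).
  rewrite S//; have /integrableP[_] := ig.
  under eq_integral => x _ do rewrite /= (ger0_norm (g0 x)).
  by move=> ?; apply: lte_mul_pinfty.
have ifT : mu.-integrable [set: R] (EFin \o f).
  apply: (@L1_le _ _ R mu f g _ fg igT); exact: continuous_measurable_fun.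
split => //.
have e1 := S _ fg0 cfg (fun x => congr2 +%R (ef x) (eg x)).
have e2 := S _ g0 cg eg.
have : \int[mu]_x (f x + g x) = 2 * \int[mu]_(x in `[0, +oo[) (f x + g x).
  rewrite /Rintegral e1 fineM//; apply: integrable_fin_num => //.
  exact: (integrableD _ if0 ig).
have : \int[mu]_x g x = 2 * \int[mu]_(x in `[0, +oo[) g x.
  by rewrite /Rintegral e2 fineM//; exact: integrable_fin_num.
by move=> Eg; rewrite RintegralD// [X in _ * X]RintegralD// Eg mulrDr => /addIr.
Qed.

End half_line.

Section continuity_lambda.
Context {R : realType}.
Implicit Types f g : R -> R.

Lemma continuousMf f g : continuous f -> continuous g ->
  continuous (fun x : R => f x * g x).
Proof. by move=> cf cg x; apply: cvgM; [exact: cf|exact: cg]. Qed.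

Lemma continuousDf f g : continuous f -> continuous g ->
  continuous (fun x : R => f x + g x).
Proof. by move=> cf cg x; apply: cvgD; [exact: cf|exact: cg]. Qed.

Lemma continuous_compf f g : continuous f -> continuous g ->
  continuous (fun x : R => f (g x)).
Proof. by move=> cf cg x; apply: continuous_comp; [exact: cg|exact: cf]. Qed.

End continuity_lambda.

(** * The Cauchy kernel *)

Section cauchy_kernel.
Context {R : realType}.
Local Notation mu := (@lebesgue_measure R).

Lemma cvgy_expRM (e : R) : 0 < e -> expR (- (e * x)) @[x --> +oo] --> (0 : R).
Proof.
move=> e0; apply/cvgrPdist_le => /= d d0.
near=> x; rewrite sub0r normrN ger0_norm ?expR_ge0// expRN.
rewrite -[leRHS]invrK lef_pV2 ?posrE ?expR_gt0 ?invr_gt0//.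
apply: le_trans (expR_ge1Dx _).
rewrite -lerBlDl mulrC -ler_pdivrMr//; near: x.
Unshelve. all: end_near. Qed.

Lemma is_derive_compf (f g : R -> R) (x a b : R) :
  is_derive (g x) (1 : R) f a -> is_derive x (1 : R) g b ->
  is_derive x (1 : R) (fun y => f (g y)) (b * a).
Proof. by move=> i j; rewrite mulrC; exact: is_derive1_comp i j. Qed.

Lemma is_derive_mulr (z x : R) : is_derive x (1 : R) (fun y => y * z) z.
Proof.
by apply: is_derive_eq; rewrite scaler0 add0r /GRing.scale/= mulr1.
Qed.

Lemma is_derive_expM (e x : R) :
  is_derive x (1 : R) (fun y => expR (- (e * y))) (- e * expR (- (e * x))).
Proof.
apply: (@is_derive_compf expR (fun y => - (e * y))).
by under eq_fun do rewrite -mulNr mulrC; exact: is_derive_mulr.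
Qed.

Lemma is_derive_cosM (z x : R) :
  is_derive x (1 : R) (fun y => cos (y * z)) (- z * sin (x * z)).
Proof.
rewrite mulNr -mulrN; apply: (@is_derive_compf cos (fun y => y * z)).
exact: is_derive_mulr.
Qed.

Lemma is_derive_sinM (z x : R) :
  is_derive x (1 : R) (fun y => sin (y * z)) (z * cos (x * z)).
Proof.
apply: (@is_derive_compf sin (fun y => y * z)); exact: is_derive_mulr.
Qed.

Lemma continuous_cosM (z : R) : continuous (fun x : R => cos (x * z)).
Proof. exact: (is_derive_continuous (is_derive_cosM z)). Qed.

Lemma continuous_sinM (z : R) : continuous (fun x : R => sin (x * z)).
Proof. exact: (is_derive_continuous (is_derive_sinM z)). Qed.

Lemma continuous_expM (e : R) : continuous (fun x : R => expR (- (e * x))).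
Proof. exact: (is_derive_continuous (is_derive_expM e)). Qed.

Lemma continuous_expMnorm (e : R) : continuous (fun x : R => expR (- (e * `|x|))).
Proof.
apply: (@continuous_compf _ (fun x => expR (- (e * x))) (fun x => `|x|)).
  exact: continuous_expM.
exact: norm_continuous.
Qed.

Lemma integral_exp_cos (e z : R) : 0 < e ->
  mu.-integrable `[0, +oo[ (EFin \o (fun x => expR (- (e * x)) * cos (x * z))) /\
  \int[mu]_(x in `[0, +oo[) (expR (- (e * x)) * cos (x * z)) = e / (e ^+ 2 + z ^+ 2).
Proof.
move=> e0; have D0 : e ^+ 2 + z ^+ 2 != 0.
  by rewrite lt0r_neq0// ltr_pwDl ?exprn_gt0// sqr_ge0.
(* The real part of exp ((- e + i z) x) / (- e + i z). *)
pose F x := (e ^+ 2 + z ^+ 2)^-1 *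
  (expR (- (e * x)) * (z * sin (x * z) - e * cos (x * z))).
pose G x := - e^-1 * expR (- (e * x)).
have FE (x : R) : is_derive x (1 : R) F (expR (- (e * x)) * cos (x * z)).
  have i1 := is_derive_expM e x; have i2 := is_derive_cosM z x.
  have i3 := is_derive_sinM z x.
  have i4 : is_derive x (1 : R) (fun x => z * sin (x * z) - e * cos (x * z))
      (z * (z * cos (x * z)) - e * (- z * sin (x * z))).
    by apply: is_deriveB; apply: is_deriveZ.
  by apply: is_derive_eq; rewrite /GRing.scale/=; field.
have GE (x : R) : is_derive x (1 : R) G (expR (- (e * x))).
  have i1 := is_derive_expM e x.
  by apply: is_derive_eq; rewrite /GRing.scale/=; field; rewrite lt0r_neq0.
have fg (x : R) : `|expR (- (e * x)) * cos (x * z)| <= expR (- (e * x)).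
  rewrite normrM (ger0_norm (expR_ge0 _)) -[leRHS]mulr1 ler_wpM2l ?expR_ge0//.
  exact: cos_max.
have Fl : F x @[x --> +oo] --> (0 : R).
  rewrite -(mulr0 (e ^+ 2 + z ^+ 2)^-1); apply: cvgMr.
  apply/cvgr0Pnorm_le => d d0.
  have K0 : 0 < `|z| + `|e| by rewrite ltr_wpDl// normr_gt0 gt_eqF.
  have := cvgy_expRM e0 => /cvgr0Pnorm_le /(_ (d / (`|z| + `|e|))).
  rewrite divr_gt0// => /(_ isT); apply: filterS => x.
  rewrite ler_pdivlMr// => h; apply: le_trans h; rewrite normrM ler_wpM2l//.
  rewrite (le_trans (ler_normB _ _))// !normrM lerD//.
    by rewrite -[leRHS]mulr1 ler_wpM2l// sin_max.
  by rewrite -[leRHS]mulr1 ler_wpM2l// cos_max.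
have Gl : G x @[x --> +oo] --> (0 : R).
  by rewrite -(mulr0 (- e^-1)); apply: cvgMr; exact: cvgy_expRM.
have cf : continuous (fun x : R => expR (- (e * x)) * cos (x * z)).
  by apply: continuousMf; [exact: continuous_expM|exact: continuous_cosM].
have [ii ->] := dominated_FTC2y cf (@continuous_expM e) (fun x (_ : 0 <= x) => fg x) FE GE Fl Gl.
split => //; rewrite /F !mulr0 oppr0 expR0 mul0r sin0 cos0; field => //.
Qed.

Lemma integrable_expMnorm (e : R) : 0 < e ->
  mu.-integrable [set: R] (EFin \o (fun x => expR (- (e * `|x|)))).
Proof.
move=> e0; have [i1 _] := integral_exp_cos 0 e0.
have ce := @continuous_expMnorm e.
have [] // : mu.-integrable [set: R] (EFin \o (fun x => expR (- (e * `|x|)))) /\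
   \int[mu]_x expR (- (e * `|x|)) =
   2 * \int[mu]_(x in `[0, +oo[) expR (- (e * `|x|)).
apply: (even_integral ce ce).
- by move=> x; rewrite ger0_norm ?expR_ge0.
- by move=> x; rewrite normrN.
- by move=> x; rewrite normrN.
- apply: eq_integrable i1 => // x; rewrite inE/= in_itv/= andbT => x0.
  by rewrite mulr0 cos0 mulr1 ger0_norm.
Qed.

(** The cosine transform of the Abel weight exp (- e |x|) is the Cauchy kernel. This weight serves
    as the regularization in the inversion formula; its transform has an elementary primitive. *)
Lemma integral_expnorm_cos (e z : R) : 0 < e ->
  \int[mu]_x (expR (- (e * `|x|)) * cos (x * z)) = 2 * e / (e ^+ 2 + z ^+ 2).
Proof.
move=> e0; have [i1 E1] := integral_exp_cos z e0.
have cf : continuous (fun x : R => expR (- (e * `|x|)) * cos (x * z)).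
  by apply: continuousMf; [exact: continuous_expMnorm|exact: continuous_cosM].
have [_ ->] : mu.-integrable [set: R]
    (EFin \o (fun x : R => expR (- (e * `|x|)) * cos (x * z))) /\
    \int[mu]_x (expR (- (e * `|x|)) * cos (x * z)) =
    2 * \int[mu]_(x in `[0, +oo[) (expR (- (e * `|x|)) * cos (x * z)).
  apply: (even_integral cf (@continuous_expMnorm e)).
  - move=> x; rewrite normrM (ger0_norm (expR_ge0 _)) -[leRHS]mulr1.
    by rewrite ler_wpM2l ?expR_ge0// cos_max.
  - by move=> x; rewrite normrN mulNr cosN.
  - by move=> x; rewrite normrN.
  - by apply: integrableS (integrable_expMnorm e0).
rewrite -mulrA -E1; congr (_ * _); apply: eq_Rintegral => x.
by rewrite inE/= in_itv/= andbT => x0; rewrite ger0_norm.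
Qed.

Lemma integrable_oneDsqrV : mu.-integrable [set: R] (EFin \o (fun x => (1 + x ^+ 2)^-1)) /\
  \int[mu]_x (1 + x ^+ 2)^-1 = pi.
Proof.
have c : continuous (fun x : R => (1 + x ^+ 2)^-1) by exact: continuous_oneDsqrV.
have p (x : R) : 0 <= (1 + x ^+ 2)^-1 by rewrite invr_ge0 addr_ge0 ?sqr_ge0.
have E := @integral0y_oneDsqr R.
have [i ->] : mu.-integrable [set: R] (EFin \o (fun x => (1 + x ^+ 2)^-1)) /\
    \int[mu]_x (1 + x ^+ 2)^-1 = 2 * \int[mu]_(x in `[0, +oo[) (1 + x ^+ 2)^-1.
  apply: (even_integral c c).
  - by move=> x; rewrite ger0_norm.
  - by move=> x; rewrite sqrrN.
  - by move=> x; rewrite sqrrN.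
  - apply/integrableP; split.
      by apply/measurable_EFinP/measurable_funTS; exact: continuous_measurable_fun.
    under eq_integral => x _ do rewrite /= (ger0_norm (p x)).
    by rewrite [X in (X < _)%E]E ltry.
split => //; by rewrite /Rintegral [X in fine X]E /= mulrC divfK.
Qed.

End cauchy_kernel.

(** * Fourier inversion *)

Section fourier.
Context {R : realType}.
Local Notation mu := (@lebesgue_measure R).
Local Notation L1 f := (mu.-integrable [set: R] (EFin \o f)).
Implicit Types (h g k : R -> R).

Definition cosT h (xi : R) : R := \int[mu]_y (h y * cos (y * xi)).
Definition sinT h (xi : R) : R := \int[mu]_y (h y * sin (y * xi)).

Lemma L1M_bounded h g : L1 h -> measurable_fun [set: R] g ->
  (forall x, `|g x| <= 1) -> L1 (fun x => h x * g x).
Proof.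
move=> ih mg g1; apply: (@L1_le _ _ R mu _ (fun x => `|h x|)).
- by apply: measurable_funM => //; exact: measurable_L1 ih.
- by move=> x; rewrite normrM -[leRHS]mulr1 ler_wpM2l.
- exact: L1_norm.
Qed.

Lemma measurable_cosM (z : R) : measurable_fun [set: R] (fun x => cos (x * z)).
Proof. by apply: continuous_measurable_fun; exact: continuous_cosM. Qed.

Lemma measurable_sinM (z : R) : measurable_fun [set: R] (fun x => sin (x * z)).
Proof. by apply: continuous_measurable_fun; exact: continuous_sinM. Qed.

Lemma L1_cosM h (z : R) : L1 h -> L1 (fun x => h x * cos (x * z)).
Proof.
move=> ih; apply: L1M_bounded => //; first exact: measurable_cosM.
by move=> x; exact: cos_max.
Qed.

Lemma L1_sinM h (z : R) : L1 h -> L1 (fun x => h x * sin (x * z)).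
Proof.
move=> ih; apply: L1M_bounded => //; first exact: measurable_sinM.
by move=> x; exact: sin_max.
Qed.

Lemma continuous_cosT h : L1 h -> continuous (cosT h).
Proof.
move=> ih; apply: continuous_Rintegral.
- by move=> x; exact: L1_cosM.
- move=> y; under eq_fun do rewrite (mulrC y).
  by apply: continuousMf; [move=> ?; exact: cvg_cst|exact: continuous_cosM].
- move=> M; exists (fun y => `|h y|); first exact: L1_norm.
  by move=> x y _; rewrite normrM -[leRHS]mulr1 ler_wpM2l// cos_max.
Qed.

Lemma continuous_sinT h : L1 h -> continuous (sinT h).
Proof.
move=> ih; apply: continuous_Rintegral.
- by move=> x; exact: L1_sinM.
- move=> y; under eq_fun do rewrite (mulrC y).
  by apply: continuousMf; [move=> ?; exact: cvg_cst|exact: continuous_sinM].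
- move=> M; exists (fun y => `|h y|); first exact: L1_norm.
  by move=> x y _; rewrite normrM -[leRHS]mulr1 ler_wpM2l// sin_max.
Qed.

Lemma ge0_integral_affine g (x e : R) : 0 < e -> continuous g ->
  (forall y, 0 <= g y) ->
  (\int[mu]_y (g y)%:E = \int[mu]_z (e * g (x + e * z))%:E)%E.
Proof.
move=> e0 cg g0; pose F z := x + e * z.
have FE (z : R) : is_derive z (1 : R) F e.
  by rewrite /F; apply: is_derive_eq; rewrite /GRing.scale/=; ring.
have F'E : derive1 F = cst e.
  by apply/funext => z; rewrite derive1E; have [] := FE z.
rewrite (@increasing_ge0_integration_by_substitutionT _ F) ?F'E//.
- by apply: eq_integral => z _ /=; rewrite mulrC.
- by move=> u v uv; rewrite ltrD2l ltr_pM2l.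
- by move=> z; exact: cvg_cst.
- exact: is_cvg_cst.
- exact: is_cvg_cst.
- apply/cvgrNyPle => A; near=> z; rewrite -lerBrDl mulrC -ler_pdivlMr//.
- apply/cvgryPge => A; near=> z; rewrite -lerBlDl mulrC -ler_pdivrMr//.
Unshelve. all: end_near. Qed.

Lemma Rintegral_affine g k (x e : R) : 0 < e -> continuous g -> continuous k ->
  (forall y, `|g y| <= k y) -> L1 k ->
  L1 (fun z => e * k (x + e * z)) /\
  \int[mu]_y g y = \int[mu]_z (e * g (x + e * z)).
Proof.
move=> e0 cg ck gk ik.
have k0 y : 0 <= k y by rewrite (le_trans _ (gk y)).
have gk0 y : 0 <= g y + k y.
  by have := gk y; rewrite ler_norml => /andP[? _]; rewrite -lerBlDr sub0r.
have ce (f : R -> R) : continuous f -> continuous (fun z : R => e * f (x + e * z)).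
  move=> cf; apply: continuousMf; first by move=> ?; exact: cvg_cst.
  apply: (@continuous_compf _ f (fun z => x + e * z)) => //.
  apply: continuousDf; first by move=> ?; exact: cvg_cst.
  by apply: continuousMf; [move=> ?; exact: cvg_cst|move=> ?; exact: cvg_id].
have Ek := ge0_integral_affine x e0 ck k0.
have Egk := ge0_integral_affine x e0 (continuousDf cg ck) gk0.
have ike : L1 (fun z => e * k (x + e * z)).
  apply/integrableP; split.
    by apply/measurable_EFinP; apply: continuous_measurable_fun; exact: ce.
  have /integrableP[_] := ik.
  under eq_integral => y _ do rewrite /= (ger0_norm (k0 y)).
  by rewrite Ek; under [X in _ -> (X < _)%E]eq_integral => y _ do
    rewrite /= ger0_norm ?mulr_ge0 ?(ltW e0)//.
have ige : L1 (fun z => e * g (x + e * z)).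
  apply: (@L1_le _ _ R mu _ _ _ _ ike).
    by apply: continuous_measurable_fun; exact: ce.
  by move=> z; rewrite normrM (gtr0_norm e0) ler_pM2l.
have ig : L1 g.
  by apply: (@L1_le _ _ R mu _ _ _ gk ik); exact: continuous_measurable_fun.
split => //.
apply: (@addIr _ (\int[mu]_y k y)).
have {2}-> : \int[mu]_y k y = \int[mu]_z (e * k (x + e * z)).
  by rewrite /Rintegral Ek.
rewrite -RintegralD// -RintegralD//.
have -> : \int[mu]_y (g y + k y) = \int[mu]_z (e * (g (x + e * z) + k (x + e * z))).
  by rewrite /Rintegral Egk.
by apply: eq_Rintegral => z _; rewrite mulrDr.
Qed.

Lemma cauchy_kernelE (e : R) (x y : R) : 0 < e ->
  e * (2 * e / (e ^+ 2 + (x - (x + e * y)) ^+ 2)) = 2 * (1 + y ^+ 2)^-1.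
Proof.
move=> e0; have y0 : 1 + y ^+ 2 != 0 by rewrite lt0r_neq0// ltr_pwDl// sqr_ge0.
have -> : e ^+ 2 + (x - (x + e * y)) ^+ 2 = e ^+ 2 * (1 + y ^+ 2) by ring.
by field; rewrite y0 lt0r_neq0.
Qed.

(** The Abel weight makes the double integral over [xi] and [y] absolutely convergent. Fubini then
    turns the [xi]-integral into a Cauchy kernel of width [e] centred at [x], and y = x + e z
    rescales that kernel to width 1. *)
Lemma fourier_regularized h (K e x : R) : 0 < e -> continuous h ->
  (forall y, `|h y| <= K) -> L1 h ->
  \int[mu]_xi (expR (- (e * `|xi|)) *
    (cosT h xi * cos (xi * x) + sinT h xi * sin (xi * x)))
  = \int[mu]_z (h (x + e * z) * (2 * (1 + z ^+ 2)^-1)).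
Proof.
move=> e0 ch hK ih.
pose f (p : R * R) := expR (- (e * `|p.1|)) * (h p.2 * cos (p.1 * (x - p.2))).
have mh := measurable_L1 ih.
have mf : measurable_fun [set: measurableTypeR R * measurableTypeR R] f.
  apply: measurable_funM.
    apply: (measurable_compC (@continuous_expMnorm _ e)).
    exact: measurable_fst.
  apply: measurable_funM; first by apply: measurable_compR; last exact: measurable_snd.
  apply: (measurable_compC (@continuous_cos R)).
  apply: measurable_funM; first exact: measurable_fst.
  by apply: measurable_funB; [exact: measurable_cst|exact: measurable_snd].
have fb a y : `|f (a, y)| <= expR (- (e * `|a|)) * `|h y|.
  rewrite normrM (ger0_norm (expR_ge0 _)) ler_wpM2l ?expR_ge0// normrM.
  by rewrite -[leRHS]mulr1 ler_wpM2l// cos_max.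
transitivity (\int[mu]_xi \int[mu]_y f (xi, y)).
  apply: eq_Rintegral => xi _; rewrite /f/= RintegralZl//; last first.
    apply: L1M_bounded => //; last by move=> ?; exact: cos_max.
    apply: (measurable_compC (@continuous_cos R)).
    by apply: measurable_funM => //; exact: measurable_funB.
  congr (_ * _); rewrite /cosT /sinT -RintegralZr//; last exact: L1_cosM.
  rewrite -RintegralZr//; last exact: L1_sinM.
  rewrite -RintegralD//; last 2 first.
  - by apply: L1M_bounded; [exact: L1_cosM|exact: measurable_cst|
      move=> _; exact: cos_max].
  - by apply: L1M_bounded; [exact: L1_sinM|exact: measurable_cst|
      move=> _; exact: sin_max].
  apply: eq_Rintegral => y _.
  by rewrite mulrBr cosB (mulrC xi y); ring.
rewrite (RFubini mf (integrable_expMnorm e0) (L1_norm ih) fb).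
transitivity (\int[mu]_y (h y * (2 * e / (e ^+ 2 + (x - y) ^+ 2)))).
  apply: eq_Rintegral => y _; rewrite /f/=.
  under eq_Rintegral do rewrite mulrCA.
  rewrite RintegralZl//; first by rewrite integral_expnorm_cos.
  apply: L1M_bounded; [exact: integrable_expMnorm|exact: measurable_cosM|].
  by move=> ?; exact: cos_max.
have K0 : 0 <= K by rewrite (le_trans _ (hK 0)).
have D0 y : 0 < e ^+ 2 + (x - y) ^+ 2 by rewrite ltr_pwDl ?exprn_gt0// sqr_ge0.
have ck : continuous (fun y : R => 2 * e / (e ^+ 2 + (x - y) ^+ 2)).
  apply: continuousMf; first by move=> ?; exact: cvg_cst.
  move=> y; apply: cvgV; first by rewrite gt_eqF.
  apply: cvgD; first exact: cvg_cst.
  have c : continuous (fun y : R => x - y).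
    by move=> z; apply: cvgB; [exact: cvg_cst|exact: cvg_id].
  exact: (continuousMf c c).
have k0 y : 0 <= 2 * e / (e ^+ 2 + (x - y) ^+ 2).
  by rewrite divr_ge0// ?mulr_ge0// ltW.
have ik : L1 (fun y : R => 2 * e / (e ^+ 2 + (x - y) ^+ 2)).
  apply/integrableP; split; first by apply/measurable_EFinP; exact: continuous_measurable_fun.
  under eq_integral => y _ do rewrite /= (ger0_norm (k0 y)).
  rewrite (ge0_integral_affine x e0 ck k0).
  under eq_integral => y _ do rewrite cauchy_kernelE//.
  have /integrableP[_] := L1Zl 2 (@integrable_oneDsqrV R).1.
  apply: le_lt_trans; rewrite le_eqVlt; apply/orP; left; apply/eqP.
  apply: eq_integral => y _ /=; rewrite ger0_norm// mulr_ge0// invr_ge0.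
  by rewrite addr_ge0// sqr_ge0.
have chk := continuousMf ch ck.
have cKk : continuous (fun y : R => K * (2 * e / (e ^+ 2 + (x - y) ^+ 2))).
  by apply: continuousMf => //; move=> ?; exact: cvg_cst.
have hKk y : `|h y * (2 * e / (e ^+ 2 + (x - y) ^+ 2))|
    <= K * (2 * e / (e ^+ 2 + (x - y) ^+ 2)).
  by rewrite normrM (ger0_norm (k0 y)) ler_wpM2r.
have [_ ->] := Rintegral_affine x e0 chk cKk hKk (L1Zl K ik).
by apply: eq_Rintegral => z _; rewrite mulrCA cauchy_kernelE.
Qed.

(** Let the width tend to 0 in [fourier_regularized]. On the left the Abel weight tends to 1 under
    the integrable bound [|a|]; on the right [h (x + e z)] tends to [h x] against the kernel 2 / (1
    + z^2), whose mass is 2 pi. *)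
Lemma fourier_inversion h (K x : R) : continuous h ->
  (forall y, `|h y| <= K) -> L1 h -> L1 (cosT h) -> L1 (sinT h) ->
  \int[mu]_xi (cosT h xi * cos (xi * x) + sinT h xi * sin (xi * x))
  = 2 * pi * h x.
Proof.
move=> ch hK ih ic is_.
have K0 : 0 <= K by rewrite (le_trans _ (hK 0)).
set a := fun xi => cosT h xi * cos (xi * x) + sinT h xi * sin (xi * x).
have ia : L1 a by apply: L1D; [exact: L1_cosM|exact: L1_sinM].
pose e (n : nat) : R := n.+1%:R^-1.
have e0 n : 0 < e n by rewrite invr_gt0.
have ecvg : e n @[n --> \oo] --> (0 : R) by exact: cvg_harmonic.
have l1 : \int[mu]_xi (expR (- (e n * `|xi|)) * a xi) @[n --> \oo] -->
    \int[mu]_xi a xi.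
  apply: (@Rdominated_cvg _ _ R mu (fun n xi => expR (- (e n * `|xi|)) * a xi) a
    (fun xi => `|a xi|)).
  - move=> n; apply: measurable_funM; last exact: measurable_L1 ia.
    by apply: continuous_measurable_fun; exact: continuous_expMnorm.
  - move=> xi; rewrite -[X in _ --> X]mul1r -[X in X * _]expR0.
    apply: cvgM; last exact: cvg_cst.
    apply: continuous_cvg; first exact: continuous_expR.
    by rewrite -[X in _ --> X]oppr0 -[X in - X](mul0r `|xi|); apply: cvgN;
      apply: cvgM => //; exact: cvg_cst.
  - move=> n xi; rewrite normrM -[leRHS]mul1r ler_wpM2r// ger0_norm ?expR_ge0//.
    by rewrite expR_le1 oppr_le0 mulr_ge0// ltW.
  - exact: L1_norm.
have io := L1Zl 2 (@integrable_oneDsqrV R).1.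
have mo := measurable_L1 io.
have l2 : \int[mu]_z (h (x + e n * z) * (2 * (1 + z ^+ 2)^-1)) @[n --> \oo] -->
    \int[mu]_z (h x * (2 * (1 + z ^+ 2)^-1)).
  apply: (@Rdominated_cvg _ _ R mu
    (fun n z => h (x + e n * z) * (2 * (1 + z ^+ 2)^-1)) _
    (fun z => K * (2 * (1 + z ^+ 2)^-1))).
  - move=> n; apply: measurable_funM => //; apply: continuous_measurable_fun.
    apply: (@continuous_compf _ h (fun z => x + e n * z)) => //.
    apply: continuousDf; first by move=> ?; exact: cvg_cst.
    by apply: continuousMf; [move=> ?; exact: cvg_cst|move=> ?; exact: cvg_id].
  - move=> z; apply: cvgM; last exact: cvg_cst.
    apply: continuous_cvg; first exact: ch.
    rewrite -[X in _ --> X]addr0 -[X in _ + X](mul0r z).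
    by apply: cvgD; [exact: cvg_cst|apply: cvgM => //; exact: cvg_cst].
  - move=> n z; rewrite normrM (@ger0_norm _ (2 * _)) ?ler_wpM2r//.
    + by rewrite mulr_ge0// invr_ge0 addr_ge0// sqr_ge0.
    + by rewrite mulr_ge0// invr_ge0 addr_ge0// sqr_ge0.
  - exact: L1Zl.
have E n : \int[mu]_xi (expR (- (e n * `|xi|)) * a xi) =
    \int[mu]_z (h (x + e n * z) * (2 * (1 + z ^+ 2)^-1)).
  exact: fourier_regularized hK ih.
rewrite (funext E) in l1.
rewrite (cvg_unique _ l1 l2)// RintegralZl// RintegralZl//; last first.
  exact: integrable_oneDsqrV.1.
by rewrite integrable_oneDsqrV.2 mulrC.
Qed.

End fourier.

(** * Decay of the transforms of a test function *)

Section compact_support.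
Context {R : realType}.
Local Notation mu := (@lebesgue_measure R).
Local Notation L1 f := (mu.-integrable [set: R] (EFin \o f)).
Implicit Types (f g h F : R -> R).

Lemma smooth_compact_is_derive h (n : nat) (x : R) : smooth_compact_support h ->
  is_derive x (1 : R) (derive1n n h) (derive1n n.+1 h x).
Proof. by move=> [dh _]; rewrite derive1nS derive1E; exact/derivableP. Qed.

Lemma smooth_compact_continuous h (n : nat) : smooth_compact_support h ->
  continuous (derive1n n h).
Proof.
by move=> sh; apply: is_derive_continuous => x; exact: smooth_compact_is_derive.
Qed.

(** One [N] serves all derivatives: the region [N < |x|] is open, so a function vanishing on it has
    a derivative vanishing on it. *)
Lemma smooth_compact_vanish h : smooth_compact_support h ->
  exists2 N : R, 0 < N & forall n x, N < `|x| -> derive1n n h x = 0.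
Proof.
move=> [dh /compact_bounded[M [_ hM]]].
exists (`|M| + 1); first by rewrite ltr_wpDl.
elim=> [|n IHn] x Nx.
  apply/eqP/negPn/negP => hx0.
  have M1 : M < `|M| + 1 by rewrite (le_lt_trans (ler_norm M))// ltrDl.
  have := hM _ M1 x (@subset_closure _ [set x | h x != 0] x hx0).
  by rewrite /= leNgt Nx.
rewrite derive1nS derive1E.
have : \forall y \near x, derive1n n h y = cst 0 y.
  have : `|y| @[y --> x] --> `|x| by exact: norm_continuous.
  by move=> /cvgr_gt/(_ _ Nx); apply: filterS => y; exact: IHn.
move=> E; rewrite (near_eq_derive _ E).
by rewrite derive_cst.
Qed.

(** The margin 1 puts the endpoints strictly beyond [N], where the primitive in
    [Rintegral_derive_compact] is known to vanish. *)
Lemma Rintegral_compact f (N : R) : (forall x, N < `|x| -> f x = 0) ->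
  \int[mu]_x f x = \int[mu]_(x in `[(- (N + 1)), (N + 1)]) f x.
Proof.
move=> f0; rewrite [RHS]Rintegral_mkcond; congr Rintegral; apply/funext => x.
rewrite /patch; case: ifPn => //; rewrite notin_setE /= in_itv/= => /negP.
rewrite -ler_norml -ltNge => Nx; apply: f0; apply: lt_trans Nx.
by rewrite ltrDl.
Qed.

Lemma L1_compact f (N : R) : continuous f ->
  (forall x, N < `|x| -> f x = 0) -> L1 f.
Proof.
move=> cf f0.
have -> : EFin \o f = (EFin \o f) \_ `[(- (N + 1)), (N + 1)]%classic.
  apply/funext => x; rewrite /patch /=; case: ifPn => //.
  rewrite notin_setE /= in_itv/= => /negP.
  rewrite -ler_norml -ltNge => Nx; rewrite f0//; apply: lt_trans Nx.
  by rewrite ltrDl.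
have i : mu.-integrable `[(- (N + 1)), (N + 1)] (EFin \o f).
  apply: continuous_compact_integrable; first exact: segment_compact.
  exact: continuous_subspaceT.
by apply: (@integrable_mkcond _ _ R mu _ _ _).1 i.
Qed.

Lemma Rintegral_derive_compact F f (N : R) : 0 < N -> continuous f ->
  (forall x, is_derive x (1 : R) F (f x)) ->
  (forall x, N < `|x| -> F x = 0) -> (forall x, N < `|x| -> f x = 0) ->
  \int[mu]_x f x = 0.
Proof.
move=> N0 cf FE F0 f0; rewrite (Rintegral_compact f0) /Rintegral.
have cF := is_derive_continuous FE.
have N1 : N < N + 1 by rewrite ltrDl.
have NN : 0 < N + 1 by rewrite ltr_wpDr.
rewrite (@continuous_FTC2 _ f F).
- have -> : F (N + 1) = 0 by rewrite F0// gtr0_norm.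
  have -> : F (- (N + 1)) = 0 by rewrite F0// normrN gtr0_norm.
  by rewrite -EFinB subrr.
- by rewrite gtrN.
- exact: continuous_subspaceT.
- split; first by move=> x _; have [] := FE x.
  + by apply: cvg_at_right_filter; exact: cF.
  + by apply: cvg_at_left_filter; exact: cF.
- by move=> x _; rewrite derive1E; have [] := FE x.
Qed.

Section green.
Variables (f0 f1 f2 : R -> R) (N : R).
Hypotheses (N0 : 0 < N) (d0 : forall x, is_derive x (1 : R) f0 (f1 x))
  (d1 : forall x, is_derive x (1 : R) f1 (f2 x)) (c2 : continuous f2).
Hypotheses (z0 : forall x, N < `|x| -> f0 x = 0)
  (z1 : forall x, N < `|x| -> f1 x = 0) (z2 : forall x, N < `|x| -> f2 x = 0).

Let c0 := is_derive_continuous d0.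
Let i0 := L1_compact c0 z0.
Let i2 := L1_compact c2 z2.

(** Green's identity in place of two integrations by parts: (f'' + xi^2 f) cos (y xi) is the
    derivative of f' cos (y xi) + xi f sin (y xi), which vanishes far out. *)
Lemma cosT_derive2 (xi : R) : cosT f2 xi = - xi ^+ 2 * cosT f0 xi.
Proof.
apply/eqP; rewrite mulNr -addr_eq0; apply/eqP.
rewrite /cosT -RintegralZl//; last exact: L1_cosM.
rewrite -RintegralD//; last 2 first.
- exact: L1_cosM.
- by apply: L1Zl; exact: L1_cosM.
apply: (@Rintegral_derive_compact
  (fun y => f1 y * cos (y * xi) + xi * (f0 y * sin (y * xi))) _ N) => //.
- apply: continuousDf; first exact: (continuousMf c2 (@continuous_cosM _ _)).
  apply: continuousMf; first by move=> ?; exact: cvg_cst.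
  exact: (continuousMf c0 (@continuous_cosM _ _)).
- move=> x; have e0 := d0 x; have e1 := d1 x.
  have e3 := is_derive_cosM xi x; have e4 := is_derive_sinM xi x.
  by apply: is_derive_eq; rewrite /GRing.scale/=; ring.
- by move=> x Nx; rewrite z0// z1//; ring.
- by move=> x Nx; rewrite z0// z2//; ring.
Qed.

Lemma sinT_derive2 (xi : R) : sinT f2 xi = - xi ^+ 2 * sinT f0 xi.
Proof.
apply/eqP; rewrite mulNr -addr_eq0; apply/eqP.
rewrite /sinT -RintegralZl//; last exact: L1_sinM.
rewrite -RintegralD//; last 2 first.
- exact: L1_sinM.
- by apply: L1Zl; exact: L1_sinM.
apply: (@Rintegral_derive_compact
  (fun y => f1 y * sin (y * xi) - xi * (f0 y * cos (y * xi))) _ N) => //.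
- apply: continuousDf; first exact: (continuousMf c2 (@continuous_sinM _ _)).
  apply: continuousMf; first by move=> ?; exact: cvg_cst.
  exact: (continuousMf c0 (@continuous_sinM _ _)).
- move=> x; have e0 := d0 x; have e1 := d1 x.
  have e3 := is_derive_cosM xi x; have e4 := is_derive_sinM xi x.
  by apply: is_derive_eq; rewrite /GRing.scale/=; ring.
- by move=> x Nx; rewrite z0// z1//; ring.
- by move=> x Nx; rewrite z0// z2//; ring.
Qed.

End green.

Lemma norm_cosT_le h (xi : R) : L1 h -> `|cosT h xi| <= \int[mu]_y `|h y|.
Proof.
move=> ih; apply: normr_Rintegral_le; [|exact: L1_cosM|exact: L1_norm].
by move=> y; rewrite normrM -[leRHS]mulr1 ler_wpM2l// cos_max.
Qed.

Lemma norm_sinT_le h (xi : R) : L1 h -> `|sinT h xi| <= \int[mu]_y `|h y|.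
Proof.
move=> ih; apply: normr_Rintegral_le; [|exact: L1_sinM|exact: L1_norm].
by move=> y; rewrite normrM -[leRHS]mulr1 ler_wpM2l// sin_max.
Qed.

Lemma decay_of_bounds (v xi a b : R) : `|v| <= a -> `|xi ^+ 4 * v| <= b ->
  `|v| <= 2 * (a + b) / (1 + xi ^+ 2) ^+ 2.
Proof.
move=> va vb; rewrite ler_pdivlMr; last first.
  by rewrite exprn_gt0// ltr_pwDl// sqr_ge0.
have x4 : 0 <= xi ^+ 4 by rewrite (exprM xi 2 2) sqr_ge0.
move: vb; rewrite normrM (ger0_norm x4) => vb.
(* (1 + xi^2)^2 <= 2 (1 + xi^4), because (1 - xi^2)^2 >= 0. *)
apply: (@le_trans _ _ (`|v| * (2 * (1 + xi ^+ 4)))).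
  by apply: ler_wpM2l => //; have := sqr_ge0 (1 - xi ^+ 2); nra.
by lra.
Qed.

(** Green's identity applied twice gives [xi^4] times each transform as the transform of the fourth
    derivative. Fourth order is chosen so that a factor 1 + xi^2 can later be absorbed and
    integrability remains. *)
Lemma smooth_compact_decay h : smooth_compact_support h ->
  exists2 K : R, 0 <= K & forall xi,
    `|cosT h xi| <= K / (1 + xi ^+ 2) ^+ 2 /\
    `|sinT h xi| <= K / (1 + xi ^+ 2) ^+ 2.
Proof.
move=> sh; have [N N0 zh] := smooth_compact_vanish sh.
pose D n := derive1n n h.
have dD n x : is_derive x (1 : R) (D n) (D n.+1 x) by exact: smooth_compact_is_derive.
have cD n : continuous (D n) by exact: smooth_compact_continuous.
have iD n : L1 (D n) by exact: (L1_compact (cD n) (zh n)).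
exists (2 * (\int[mu]_y `|h y| + \int[mu]_y `|D 4%N y|)).
  by rewrite mulr_ge0// addr_ge0// Rintegral_ge0.
have P n := (@cosT_derive2 _ _ _ N N0 (dD n) (dD n.+1) (cD n.+2) (zh n)
   (zh n.+1) (zh n.+2)).
have Q n := (@sinT_derive2 _ _ _ N N0 (dD n) (dD n.+1) (cD n.+2) (zh n)
   (zh n.+1) (zh n.+2)).
move=> xi; split; apply: decay_of_bounds.
- exact: norm_cosT_le (iD 0%N).
- have := norm_cosT_le xi (iD 4%N); rewrite P P.
  by congr (`|_| <= _); rewrite /D/= ; ring.
- exact: norm_sinT_le (iD 0%N).
- have := norm_sinT_le xi (iD 4%N); rewrite Q Q.
  by congr (`|_| <= _); rewrite /D/= ; ring.
Qed.

End compact_support.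

(** * First moment of the Levy measure *)

Section levy.
Context {R : realType}.
Variable nu : {measure set (measurableTypeR R) -> \bar R}.
Local Notation L1 f := (nu.-integrable [set: measurableTypeR R] (EFin \o f)).

Definition min1sq (u : R) : R := Num.min 1 (u ^+ 2).
Definition minsq (u : R) : R := Num.min `|u| (u ^+ 2).

Lemma min1sq_ge0 u : 0 <= min1sq u.
Proof. by rewrite le_min ler01 sqr_ge0. Qed.

Lemma minsq_ge0 u : 0 <= minsq u.
Proof. by rewrite le_min normr_ge0 sqr_ge0. Qed.

Lemma measurable_sqr : measurable_fun [set: R] (fun u : R => u ^+ 2).
Proof. exact: measurable_funX. Qed.

Lemma measurable_min1sq : measurable_fun [set: R] min1sq.
Proof. by apply: measurable_minr => //; exact: measurable_sqr. Qed.

Lemma measurable_minsq : measurable_fun [set: R] minsq.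
Proof. by apply: measurable_minr; [exact: normr_measurable|exact: measurable_sqr]. Qed.

Definition psi (t : R) : R := \int[nu]_u (1 - cos (t * u)).

Hypothesis levy : levy_measure nu.

Lemma L1_min1sq : L1 min1sq.
Proof.
apply/integrableP; split; first by apply/measurable_EFinP; exact: measurable_min1sq.
under eq_integral => u _ do rewrite /= (ger0_norm (min1sq_ge0 u)).
by have [_] := levy.
Qed.

(** Markov's inequality bounds the measure of the superlevel sets of the integrable function
    [min1sq]. They miss only the point 0, which is null for a Levy measure. *)
Lemma levy_sigma_finite : sigma_finite [set: measurableTypeR R] nu.
Proof.
pose F n : set (measurableTypeR R) :=
  [set u | 1 <= n.+1%:R * min1sq u] `|` [set 0].
have mF1 n : measurable ([set u | 1 <= n.+1%:R * min1sq u] : set (measurableTypeR R)).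
  have mg : measurable_fun [set: measurableTypeR R] (fun u => n.+1%:R * min1sq u).
    by apply: measurable_funM => //; exact: measurable_min1sq.
  have := mg measurableT _ (measurable_itv `[(1 : R), +oo[).
  rewrite setTI; congr measurable; apply/seteqP; split => u /=;
    by rewrite in_itv/= andbT.
have m0 : measurable ([set 0] : set (measurableTypeR R)) by exact: measurable_set1.
exists F; last first.
  move=> n; split; first exact: measurableU.
  have n0 : nu [set 0] = 0%E by have [] := levy.
  have h : (nu (F n) <= nu [set u | 1 <= n.+1%:R * min1sq u]%R
      + nu [set 0%R])%E.
    exact: measureU2.
  rewrite n0 adde0 in h; apply: le_lt_trans h _.
  rewrite -[X in nu X]setIT -(integral_indic _ measurableT)//.
  have /integrableP[_] := L1Zl n.+1%:R L1_min1sq; apply: le_lt_trans.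
  apply: ge0_le_integral => //.
  - by apply/measurable_EFinP; exact: measurable_indic.
  - apply/measurable_EFinP; apply: measurableT_comp => //.
    by apply: measurable_funM => //; exact: measurable_min1sq.
  - move=> u _ /=; rewrite lee_fin indicE (ger0_norm (mulr_ge0 _ (min1sq_ge0 u)))//.
    by case: (boolP (u \in _)) => [|_]; [rewrite inE|rewrite mulr_ge0 ?min1sq_ge0].
apply/seteqP; split => // u _.
have [->|u0] := eqVneq u 0; first by exists 0%N => //; right.
have k0 : 0 < min1sq u by rewrite lt_min ltr01 exprn_even_gt0.
exists (Num.bound (min1sq u)^-1) => //; left => /=.
rewrite -ler_pdivrMr// div1r (le_trans (ltW (archi_boundP _)))//.
  by rewrite invr_ge0 ltW.
by rewrite ler_nat.
Qed.

Lemma onemcos_le_min1sq (t u : R) : 1 - cos (t * u) <= (2 + t ^+ 2) * min1sq u.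
Proof.
rewrite /min1sq /Num.min; case: ifPn => _.
  by have := onemcos_le2 (t * u); have := sqr_ge0 t; lra.
have := onemcos_le (t * u); have := sqr_ge0 u; rewrite exprMn; nra.
Qed.

Lemma measurable_cosMl (t : R) : measurable_fun [set: R] (fun u => cos (t * u)).
Proof. by under eq_fun do rewrite mulrC; exact: measurable_cosM. Qed.

Lemma measurable_sinMl (t : R) : measurable_fun [set: R] (fun u => sin (t * u)).
Proof. by under eq_fun do rewrite mulrC; exact: measurable_sinM. Qed.

Lemma L1_onemcos (t : R) : L1 (fun u => 1 - cos (t * u)).
Proof.
apply: (@L1_le _ _ R nu _ (fun u => (2 + t ^+ 2) * min1sq u)).
- by apply: measurable_funB; [exact: measurable_cst|exact: measurable_cosMl].
- by move=> u; rewrite ger0_norm ?onemcos_ge0// onemcos_le_min1sq.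
- exact: L1Zl L1_min1sq.
Qed.

Lemma psi_ge0 t : 0 <= psi t.
Proof. by apply: Rintegral_ge0 => u _; exact: onemcos_ge0. Qed.

Definition dyadic_sum n (y : R) : R :=
  \sum_(k < n) 2 ^+ k * (1 - cos (2 ^- k * y)).

Lemma dyadic_sum_ge0 n y : 0 <= dyadic_sum n y.
Proof. by apply: sumr_ge0 => k _; rewrite mulr_ge0 ?exprn_ge0 ?onemcos_ge0. Qed.

(** Term k is at most 2^k G (y / 2^k) - 2^(k+1) G (y / 2^(k+1)) by [onemcos_telescope], so the sum
    telescopes to at most G y, and G y <= 12 |y|. *)
Lemma dyadic_sum_le n (y : R) : dyadic_sum n y <= 12 * `|y|.
Proof.
pose G (v : R) := 12 * v ^+ 2 / (1 + `|v|).
have G0 v : 0 <= G v.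
  by rewrite /G; apply: divr_ge0; [apply: mulr_ge0; rewrite ?sqr_ge0|apply: addr_ge0].
have tel : dyadic_sum n y <= G y - 2 ^+ n * G (2 ^- n * y).
  elim: n => [|n IH].
    by rewrite /dyadic_sum big_ord0 expr0 invr1 !mul1r subrr.
  rewrite /dyadic_sum big_ord_recr/= -/(dyadic_sum n y).
  have := onemcos_telescope (2 ^- n * y).
  have -> : 2 ^- n * y / 2 = 2 ^- n.+1 * y by rewrite exprS invfM; ring.
  rewrite -/(G (2 ^- n * y)) -/(G (2 ^- n.+1 * y)) => h.
  have p2 : 0 <= (2 : R) ^+ n by rewrite exprn_ge0.
  have h2 := ler_wpM2l p2 h; apply: (le_trans (lerD IH h2)).
  by move: (G y) (G (2 ^- n * y)) (G (2 ^- n.+1 * y)) => a c c'; rewrite exprS; lra.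
apply: (le_trans tel); apply: (@le_trans _ _ (G y)).
  by rewrite gerBl mulr_ge0// exprn_ge0.
rewrite /G ler_pdivrMr; last by rewrite ltr_pwDl.
rewrite -(real_normK (num_real y)); have := normr_ge0 y; nra.
Qed.

(** For |u| > 1 one term is enough. With k least such that |u| <= 2^k, the point 2^-k |u| lies in
    [1/2, 1], and the k-th term is at least 2^k (1 - cos (1/2)) >= |u| (1 - cos (1/2)). Since |u| <=
    n <= 2^n, this k is at most n. *)
Lemma minsq_le_dyadic n (u : R) : `|u| <= n%:R ->
  (1 - cos 2^-1) * minsq u <= min1sq u * (1 - cos 2^-1) + dyadic_sum n.+1 u.
Proof.
move=> un; have c0 := onemcos_ge0 (2^-1 : R).
have d0 := dyadic_sum_ge0 n.+1 u.
have [u1|u1] := leP `|u| 1.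
  have -> : min1sq u = u ^+ 2.
    by rewrite /min1sq min_r// -(real_normK (num_real u)) expr_le1.
  have : minsq u <= u ^+ 2 by rewrite /minsq ge_min lexx orbT.
  by nra.
have [k kn /andP[k1 k2]] : exists2 k : nat, (k <= n)%N & 2^-1 <= 2 ^- k * `|u| <= 1.
  have ex : exists k, `|u| <= 2 ^+ k.
    exists n; rewrite (le_trans un)// -natrX ler_nat ltnW// ltn_expl//.
  exists (ex_minn ex).
    case: ex_minnP => k _; apply; rewrite (le_trans un)// -natrX ler_nat.
    by rewrite ltnW// ltn_expl.
  case: ex_minnP => -[|k] uk kmin.
    by move: uk; rewrite expr0 leNgt u1.
  rewrite mulrC ler_pdivrMr ?exprn_gt0// mul1r uk andbT.
  rewrite ler_pdivlMr ?exprn_gt0// exprS mulKf//.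
  rewrite leNgt; apply/negP => /ltW /kmin; by rewrite ltnn.
have kn' : (k < n.+1)%N by [].
apply: (@le_trans _ _ (dyadic_sum n.+1 u)); last first.
  by rewrite lerDr mulr_ge0// min1sq_ge0.
rewrite /dyadic_sum (bigD1 (Ordinal kn'))//= -[leLHS]addr0 lerD//; last first.
  by apply: sumr_ge0 => j _; rewrite mulr_ge0 ?exprn_ge0 ?onemcos_ge0.
apply: (@le_trans _ _ ((1 - cos 2^-1) * 2 ^+ k)).
  rewrite ler_wpM2l// /minsq ge_min; apply/orP; left.
  by move: k2; rewrite mulrC ler_pdivrMr ?exprn_gt0// mul1r.
rewrite mulrC ler_wpM2l ?exprn_ge0// lerD2l lerN2.
rewrite -(cos_norm (2 ^- k * u)) normrM (@ger0_norm _ (2 ^- k)) ?invr_ge0 ?exprn_ge0//.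
(* The cosine decreases on [0, pi], which contains both 1/2 and 2^-k |u|, the latter being at most
   1. *)
have pi2 := @pi_ge2 R.
rewrite leNgt; apply/negP; rewrite ltr_cos ?in_itv/=; first by rewrite ltNge k1.
- by apply/andP; split; lra.
- by apply/andP; split; lra.
Qed.

(** * Transfer of the first moment from the law of [X] to [nu] *)

Section first_moment.
Context d (T : measurableType d) (P : probability T R) (X : {RV P >-> R}).
Hypothesis iX : P.-integrable [set: T] (EFin \o X).
Hypothesis RecharX : forall t, \int[P]_w cos (t * X w) <= expR (- psi t).

Lemma measurable_RV : measurable_fun [set: T] (X : T -> R).
Proof. exact: measurable_funPT. Qed.

Lemma L1_cosRV (t : R) : P.-integrable [set: T] (EFin \o (fun w => cos (t * X w))).
Proof.
apply: (@L1_le _ _ R P _ (cst 1)).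
- by apply: (measurable_compR (measurable_cosMl t)); exact: measurable_RV.
- by move=> w; rewrite cos_max.
- exact: finite_measure_integrable_cst.
Qed.

Lemma L1_sinRV (t : R) : P.-integrable [set: T] (EFin \o (fun w => sin (t * X w))).
Proof.
apply: (@L1_le _ _ R P _ (cst 1)).
- by apply: (measurable_compR (measurable_sinMl t)); exact: measurable_RV.
- by move=> w; rewrite sin_max.
- exact: finite_measure_integrable_cst.
Qed.

Lemma Rintegral_cstP (r : R) : \int[P]_w r = r.
Proof.
have h := probability_setT P.
by rewrite Rintegral_cst// [X in fine X]h mulr1.
Qed.

(** Here 1 - E cos (t X) >= 1 - exp (- psi) >= psi / (1 + psi). For |t| <= 1 the factor 2 + t^2 of
    [onemcos_le_min1sq] is at most 3, so psi is bounded by three times the integral of [min1sq] and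
    the denominator can be replaced by a constant. *)
Lemma psi_le_onemcos (t : R) : `|t| <= 1 ->
  psi t <= (1 + 3 * \int[nu]_u min1sq u) * \int[P]_w (1 - cos (t * X w)).
Proof.
move=> t1; have p0 := psi_ge0 t.
have pC : psi t <= 3 * \int[nu]_u min1sq u.
  rewrite -RintegralZl//; last exact: L1_min1sq.
  apply: le_Rintegral => //; [exact: L1_onemcos|exact: L1Zl L1_min1sq|].
  move=> u _; rewrite (le_trans (onemcos_le_min1sq t u))// ler_wpM2r ?min1sq_ge0//.
  have : t ^+ 2 <= 1 by rewrite -(real_normK (num_real t)) expr_le1.
  by lra.
set C := 3 * _ in pC *.
rewrite RintegralB//; last 2 first.
- exact: finite_measure_integrable_cst.
- exact: L1_cosRV.
rewrite Rintegral_cstP.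
have := expR_ge1Dx (psi t) => h1.
have h2 : expR (- psi t) <= (1 + psi t)^-1.
  by rewrite expRN lef_pV2 ?posrE ?expR_gt0//; lra.
have h3 := RecharX t.
have h4 : (1 + psi t) * (1 + psi t)^-1 = 1 by rewrite mulfV// gt_eqF//; lra.
have h5 : 0 <= (1 + psi t)^-1 by rewrite invr_ge0; lra.
apply: (@le_trans _ _ ((1 + psi t) * (1 - (1 + psi t)^-1))).
  by rewrite mulrBr h4; lra.
apply: ler_pM; [lra| |lra|lra].
by rewrite subr_ge0 invf_le1; lra.
Qed.

(** The [nu]-integral is the sum of 2^k psi (2^-k). All the arguments 2^-k are at most 1, so
    [psi_le_onemcos] compares it with the expectation of [dyadic_sum n (X w)], which is at most 12
    E|X| whatever [n] is. *)
Lemma dyadic_sum_bound : exists C : R, forall n,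
  L1 (dyadic_sum n) /\ \int[nu]_u dyadic_sum n u <= C.
Proof.
pose C0 := 1 + 3 * \int[nu]_u min1sq u.
have C00 : 0 <= C0.
  by rewrite addr_ge0// mulr_ge0// Rintegral_ge0// => u _; exact: min1sq_ge0.
exists (C0 * (12 * \int[P]_w `|X w|)) => n.
have i1 k : L1 (fun u => 2 ^+ k * (1 - cos (2 ^- k * u))).
  exact: L1Zl (L1_onemcos _).
have i2 k : P.-integrable [set: T]
    (EFin \o (fun w => 2 ^+ k * (1 - cos (2 ^- k * X w)))).
  apply: L1Zl; apply: L1B; last exact: L1_cosRV.
  exact: finite_measure_integrable_cst.
have [j1 E1] := L1_sum n i1; have [j2 E2] := L1_sum n i2.
split; first exact: j1.
rewrite /dyadic_sum E1.
apply: (@le_trans _ _ (C0 * \int[P]_w dyadic_sum n (X w))).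
  rewrite /dyadic_sum E2 mulr_sumr; apply: ler_sum => k _.
  rewrite RintegralZl//; last exact: L1_onemcos.
  rewrite RintegralZl//; last first.
    by apply: L1B; [exact: finite_measure_integrable_cst|exact: L1_cosRV].
  rewrite mulrCA ler_wpM2l ?exprn_ge0//.
  apply: psi_le_onemcos; rewrite ger0_norm ?invr_ge0 ?exprn_ge0//.
  by rewrite invf_le1 ?exprn_gt0// exprn_ege1// ler1n.
rewrite ler_wpM2l// -RintegralZl//; last exact: L1_norm.
apply: le_Rintegral => //; first by apply: L1Zl; exact: L1_norm.
by move=> w _; exact: dyadic_sum_le.
Qed.

Lemma L1_minsq : L1 minsq.
Proof.
have [C hC] := dyadic_sum_bound.
pose c : R := 1 - cos 2^-1.
have c0 : 0 < c.
  have p := @pi_ge2 R.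
  rewrite /c subr_gt0 -[X in _ < X]cos0 ltr_cos ?invr_gt0 ?in_itv//=; lra.
(* [minsq_le_dyadic] with n + 1 terms reaches only |u| <= n. The bound on the truncated integrals
   does not depend on [n], and monotone convergence removes the truncation. *)
pose g n u : R := if `|u| <= n%:R then minsq u else 0.
have g0 n u : 0 <= g n u by rewrite /g; case: ifP => _ //; exact: minsq_ge0.
have mg n : measurable_fun [set: R] (g n).
  apply: measurable_fun_ifT; [|exact: measurable_minsq|exact: measurable_cst].
  by apply: measurable_fun_ler => //; exact: normr_measurable.
have gb n : (\int[nu]_u (g n u)%:E <= (\int[nu]_u min1sq u + c^-1 * C)%:E)%E.
  have [is_ sC] := hC n.+1.
  have ib : L1 (fun u => min1sq u + c^-1 * dyadic_sum n.+1 u).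
    by apply: L1D; [exact: L1_min1sq|exact: L1Zl].
  have gle u : g n u <= min1sq u + c^-1 * dyadic_sum n.+1 u.
    rewrite /g; case: ifPn => [un|_]; last first.
      by rewrite addr_ge0 ?min1sq_ge0// mulr_ge0 ?dyadic_sum_ge0// invr_ge0 ltW.
    rewrite -(ler_pM2l c0) mulrDr mulVKf ?gt_eqF// [c * min1sq u]mulrC.
    exact: minsq_le_dyadic.
  have ig : L1 (g n).
    by apply: (@L1_le _ _ R nu (g n) _ (mg n) _ ib) => u; rewrite (ger0_norm (g0 n u)).
  have gfin : (\int[nu]_u (g n u)%:E)%E \is a fin_num by exact: integrable_fin_num.
  rewrite -(fineK gfin) lee_fin.
  apply: (@le_trans _ _ (\int[nu]_u (min1sq u + c^-1 * dyadic_sum n.+1 u))).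
    exact: le_Rintegral.
  rewrite RintegralD//; [|exact: L1_min1sq|exact: L1Zl].
  by rewrite lerD2l RintegralZl// ler_wpM2l// invr_ge0 ltW.
have mE n : measurable_fun [set: measurableTypeR R] (EFin \o g n).
  by apply/measurable_EFinP; exact: mg.
have ge0E n u : [set: measurableTypeR R] u -> (0 <= (EFin \o g n) u)%E.
  by move=> _; rewrite lee_fin.
have nd u : [set: measurableTypeR R] u ->
    {homo (fun n => (EFin \o g n) u) : n m / (n <= m)%N >-> (n <= m)%E}.
  move=> _ n m nm; rewrite /= lee_fin /g; case: ifPn => un; last first.
    by case: ifP => _ //; exact: minsq_ge0.
  by rewrite ifT// (le_trans un)// ler_nat.
have glim u : limn (fun n => (EFin \o g n) u) = (minsq u)%:E.
  apply/cvg_lim => //; apply: cvg_near_cst; near=> n; rewrite /= /g ifT//.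
  by near: n; exact: nbhs_infty_ger.
have h := @cvg_monotone_convergence _ _ _ nu _ measurableT _ mE ge0E nd.
apply/integrableP; split; first by apply/measurable_EFinP; exact: measurable_minsq.
under eq_integral => u _ do rewrite /= (ger0_norm (minsq_ge0 u)) -glim.
apply: (@le_lt_trans _ _ (\int[nu]_u min1sq u + c^-1 * C)%:E); last exact: ltry.
rewrite -(cvg_lim _ h)//; apply: lime_le; first by apply/cvg_ex; eexists; exact: h.
by apply: nearW => n; exact: gb.
Unshelve. all: end_near. Qed.

End first_moment.
End levy.

(** * The characteristic exponent *)

Section exponent.
Context {R : realType}.
Variables (nu : {measure set (measurableTypeR R) -> \bar R}) (b : R).
Local Notation L1 f := (nu.-integrable [set: measurableTypeR R] (EFin \o f)).

Definition small (u : R) : R := \1_[set v : R | `|v| <= 1] u.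

Definition theta (t : R) : R :=
  t * b + \int[nu]_u (sin (t * u) - t * u * small u).
Definition dpsi (s : R) : R := \int[nu]_u (u * sin (s * u)).
Definition dtheta (s : R) : R :=
  b + \int[nu]_u (u * cos (s * u) - u * small u).

Lemma psi0 : psi nu 0 = 0.
Proof.
rewrite /psi; under eq_Rintegral do rewrite mul0r cos0 subrr.
by rewrite /Rintegral integral0.
Qed.

Lemma theta0 : theta 0 = 0.
Proof.
rewrite /theta; under eq_Rintegral do rewrite !mul0r sin0 subrr.
by rewrite /Rintegral integral0 mul0r addr0.
Qed.

Lemma smallE (u : R) : small u = if `|u| <= 1 then 1 else 0.
Proof.
by rewrite /small indicE; case: ifPn => h;
  [rewrite mem_set|rewrite memNset//; exact/negP].
Qed.

Lemma measurable_small : measurable_fun [set: R] small.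
Proof.
apply: measurable_indic.
have -> : [set v : R | `|v| <= 1] = `[(-1)%R, 1%R]%classic.
  by apply/seteqP; split => v /=; rewrite in_itv/= ler_norml.
exact: measurable_itv.
Qed.

Lemma minsq_small (u : R) : `|u| <= 1 -> minsq u = u ^+ 2.
Proof.
move=> u1; rewrite /minsq min_r// -(real_normK (num_real u)).
by have := normr_ge0 u; nra.
Qed.

Lemma minsq_large (u : R) : 1 < `|u| -> minsq u = `|u|.
Proof.
by move=> u1; rewrite /minsq min_l// -(real_normK (num_real u)); nra.
Qed.

(** The two regimes of [minsq] are those of the sine: |sin v| <= |v| for small jumps, |sin v| <= 1
    for large ones. *)
Lemma norm_mul_sin_le (s u : R) : `|u * sin (s * u)| <= (1 + `|s|) * minsq u.
Proof.
rewrite normrM; have u0 := normr_ge0 u; have s0 := normr_ge0 s.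
have := normr_ge0 (sin (s * u)); have := sin_max (s * u).
have := norm_sin_le (s * u); rewrite normrM.
have [u1|u1] := leP `|u| 1.
  by rewrite minsq_small// -(real_normK (num_real u)); nra.
by rewrite minsq_large//; nra.
Qed.

Lemma norm_mul_cosB1_le (s u : R) :
  `|u * (cos (s * u) - 1)| <= (2 + `|s|) * minsq u.
Proof.
rewrite normrM; have u0 := normr_ge0 u; have s0 := normr_ge0 s.
have c2 : `|cos (s * u) - 1| <= 2.
  by rewrite distrC ger0_norm ?onemcos_ge0// onemcos_le2.
have := normr_ge0 (cos (s * u) - 1); have := norm_cosB1_le (s * u).
rewrite normrM; have [u1|u1] := leP `|u| 1.
  by rewrite minsq_small// -(real_normK (num_real u)); nra.
by rewrite minsq_large//; nra.
Qed.

Lemma norm_mul_cos_small_le (s u : R) :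
  `|u * cos (s * u) - u * small u| <= (3 + `|s|) * minsq u.
Proof.
have -> : u * cos (s * u) - u * small u =
    u * (cos (s * u) - 1) + u * (1 - small u) by ring.
rewrite (le_trans (ler_normD _ _))//.
have -> : (3 + `|s|) * minsq u = (2 + `|s|) * minsq u + minsq u by ring.
rewrite lerD ?norm_mul_cosB1_le// smallE; have [u1|u1] := leP `|u| 1.
  by rewrite subrr mulr0 normr0 minsq_ge0.
by rewrite subr0 mulr1 minsq_large.
Qed.

Lemma norm_sin_small_le (t u : R) :
  `|sin (t * u) - t * u * small u| <= (1 + t ^+ 2) * minsq u.
Proof.
rewrite smallE; have [u1|u1] := leP `|u| 1.
  rewrite mulr1 minsq_small//; apply: (le_trans (norm_sinB_le _)).
  by rewrite exprMn; have := sqr_ge0 u; have := sqr_ge0 t; nra.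
rewrite mulr0 subr0 minsq_large//; apply: (le_trans (sin_max _)).
by have := sqr_ge0 t; nra.
Qed.

Hypothesis levy : levy_measure nu.
Hypothesis iminsq : L1 minsq.

Lemma L1_mul_sin (s : R) : L1 (fun u => u * sin (s * u)).
Proof.
apply: (@L1_le _ _ R nu _ (fun u => (1 + `|s|) * minsq u)).
- by apply: measurable_funM => //; exact: measurable_sinMl.
- by move=> u; exact: norm_mul_sin_le.
- exact: L1Zl.
Qed.

Lemma L1_mul_cosB1 (s : R) : L1 (fun u => u * (cos (s * u) - 1)).
Proof.
apply: (@L1_le _ _ R nu _ (fun u => (2 + `|s|) * minsq u)).
- apply: measurable_funM => //.
  by apply: measurable_funB => //; exact: measurable_cosMl.
- by move=> u; exact: norm_mul_cosB1_le.
- exact: L1Zl.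
Qed.

Lemma L1_mul_cos_small (s : R) : L1 (fun u => u * cos (s * u) - u * small u).
Proof.
apply: (@L1_le _ _ R nu _ (fun u => (3 + `|s|) * minsq u)).
- apply: measurable_funB; apply: measurable_funM => //.
    exact: measurable_cosMl.
  exact: measurable_small.
- by move=> u; exact: norm_mul_cos_small_le.
- exact: L1Zl.
Qed.

Lemma L1_sin_small (t : R) : L1 (fun u => sin (t * u) - t * u * small u).
Proof.
apply: (@L1_le _ _ R nu _ (fun u => (1 + t ^+ 2) * minsq u)).
- apply: measurable_funB; first exact: measurable_sinMl.
  by apply: measurable_funM; [exact: measurable_funM|exact: measurable_small].
- by move=> u; exact: norm_sin_small_le.
- exact: L1Zl.
Qed.

Lemma is_derive_psi (t : R) : is_derive t (1 : R) (psi nu) (dpsi t).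
Proof.
apply: (@is_derive_Rintegral _ _ R nu (fun t u => 1 - cos (t * u))
  (fun t u => u * sin (t * u))).
- exact: L1_onemcos levy.
- move=> s u; have i1 := is_derive_cosM u s.
  by apply: is_derive_eq; ring.
- move=> M; exists (fun u => (1 + `|M|) * minsq u); first exact: L1Zl.
  move=> s u sM; apply: (le_trans (norm_mul_sin_le _ _)).
  by rewrite ler_wpM2r ?minsq_ge0// lerD2l (le_trans (ltW sM))// ler_norm.
Qed.

Lemma is_derive_theta (t : R) : is_derive t (1 : R) theta (dtheta t).
Proof.
have i1 : is_derive t (1 : R)
    (fun t => \int[nu]_u (sin (t * u) - t * u * small u))
    (\int[nu]_u (u * cos (t * u) - u * small u)).
  apply: (@is_derive_Rintegral _ _ R nu (fun t u => sin (t * u) - t * u * small u)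
    (fun t u => u * cos (t * u) - u * small u)).
  - exact: L1_sin_small.
  - move=> s u; have j1 := is_derive_sinM u s.
    have j2 : is_derive s (1 : R) (fun s => s * u * small u) (u * small u).
      by under eq_fun do rewrite -mulrA; exact: is_derive_mulr.
    exact: is_deriveB.
  - move=> M; exists (fun u => (3 + `|M|) * minsq u); first exact: L1Zl.
    move=> s u sM; apply: (le_trans (norm_mul_cos_small_le _ _)).
    by rewrite ler_wpM2r ?minsq_ge0// lerD2l (le_trans (ltW sM))// ler_norm.
have i2 := is_derive_mulr b t.
exact: is_deriveD.
Qed.

Lemma continuous_psi : continuous (psi nu).
Proof. exact: is_derive_continuous is_derive_psi. Qed.

Lemma continuous_theta : continuous theta.
Proof. exact: is_derive_continuous is_derive_theta. Qed.

Lemma continuous_dpsi : continuous dpsi.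
Proof.
apply: continuous_Rintegral; first exact: L1_mul_sin.
- move=> u; apply: continuousMf; first by move=> ?; exact: cvg_cst.
  exact: continuous_sinM.
- move=> M; exists (fun u => (1 + `|M|) * minsq u); first exact: L1Zl.
  move=> s u sM; apply: (le_trans (norm_mul_sin_le _ _)).
  by rewrite ler_wpM2r ?minsq_ge0// lerD2l (le_trans (ltW sM))// ler_norm.
Qed.

Lemma continuous_dtheta : continuous dtheta.
Proof.
apply: continuousDf; first by move=> ?; exact: cvg_cst.
apply: continuous_Rintegral; first exact: L1_mul_cos_small.
- move=> u; apply: continuousDf; last by move=> ?; exact: cvg_cst.
  apply: continuousMf; first by move=> ?; exact: cvg_cst.
  exact: continuous_cosM.
- move=> M; exists (fun u => (3 + `|M|) * minsq u); first exact: L1Zl.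
  move=> s u sM; apply: (le_trans (norm_mul_cos_small_le _ _)).
  by rewrite ler_wpM2r ?minsq_ge0// lerD2l (le_trans (ltW sM))// ler_norm.
Qed.

(** Subtracting the value at 0, which [ID_mean] identifies with E X, cancels [b] and the truncation.
    The Stein equation can therefore be written without either. *)
Lemma dthetaB (s : R) : dtheta s - dtheta 0 = \int[nu]_u (u * (cos (s * u) - 1)).
Proof.
rewrite /dtheta opprD addrACA subrr add0r -RintegralB//; [|exact: L1_mul_cos_small|
  exact: L1_mul_cos_small].
by apply: eq_Rintegral => u _; rewrite mul0r cos0; ring.
Qed.

Lemma norm_dpsi_le (s : R) : `|dpsi s| <= (1 + `|s|) * \int[nu]_u minsq u.
Proof.
rewrite -RintegralZl//; apply: normr_Rintegral_le.
- by move=> u; exact: norm_mul_sin_le.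
- exact: L1_mul_sin.
- exact: L1Zl.
Qed.

Lemma norm_dthetaB_le (s : R) :
  `|dtheta s - dtheta 0| <= (2 + `|s|) * \int[nu]_u minsq u.
Proof.
rewrite dthetaB -RintegralZl//; apply: normr_Rintegral_le.
- by move=> u; exact: norm_mul_cosB1_le.
- exact: L1_mul_cosB1.
- exact: L1Zl.
Qed.

End exponent.

(** * Characteristic functions and the semigroup *)

Section complex_exponential.
Context {R : realType}.
Implicit Types (r s a b : R).

Lemma cexp_neq0 r a : cexp (Complex r a) != 0.
Proof.
apply/negP => /eqP[/eqP + /eqP]; rewrite !mulf_eq0 !expR_eq0/= => /eqP c0 /eqP s0.
by have := cos2Dsin2 a; rewrite c0 s0 expr0n/= addr0 => /eqP; rewrite eq_sym oner_eq0.
Qed.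

Lemma cexp_div r a s b :
  cexp (Complex r a) / cexp (Complex s b) = cexp (Complex (r - s) (a - b)).
Proof.
apply: (canLR (mulfK (cexp_neq0 s b))).
rewrite /cexp/=; apply/eqP; rewrite eq_complex/=.
have -> : expR r = expR (r - s) * expR s by rewrite -expRD subrK.
have -> : cos a = cos (a - b) * cos b - sin (a - b) * sin b.
  by rewrite -cosD subrK.
have -> : sin a = sin (a - b) * cos b + cos (a - b) * sin b.
  by rewrite -sinD subrK.
by apply/andP; split; apply/eqP; ring.
Qed.

Lemma cexp_im a : cexp (Complex 0 a) = Complex (cos a) (sin a).
Proof. by rewrite /cexp/= expR0 !mul1r. Qed.

(** With p, q the integrals of cosine and sine, p^2 + q^2 is the integral of p cos + q sin, and
    pointwise p cos + q sin <= (p^2 + q^2 + 1) / 2. Hence p^2 + q^2 <= (p^2 + q^2 + 1) / 2. *)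
Lemma is_char_fun_norm_le1 (phi : R -> R[i]) t : is_char_fun phi ->
  complex.Re (phi t) ^+ 2 + complex.Im (phi t) ^+ 2 <= 1.
Proof.
move=> [mu /(_ t) ->]; rewrite /cintegral/=.
have -> : \int[mu]_x complex.Re (cexp (Complex 0 (t * x))) = \int[mu]_x cos (t * x).
  by apply: eq_Rintegral => x _; rewrite cexp_im.
have -> : \int[mu]_x complex.Im (cexp (Complex 0 (t * x))) = \int[mu]_x sin (t * x).
  by apply: eq_Rintegral => x _; rewrite cexp_im.
set p := \int[mu]_x cos (t * x); set q := \int[mu]_x sin (t * x).
have i1 : mu.-integrable [set: measurableTypeR R] (EFin \o cst 1).
  exact: finite_measure_integrable_cst.
have ic : mu.-integrable [set: measurableTypeR R] (EFin \o (fun x => cos (t * x))).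
  apply: (@L1_le _ _ R mu _ (cst 1)) => //; first exact: measurable_cosMl.
  by move=> x; exact: cos_max.
have is_ : mu.-integrable [set: measurableTypeR R] (EFin \o (fun x => sin (t * x))).
  apply: (@L1_le _ _ R mu _ (cst 1)) => //; first exact: measurable_sinMl.
  by move=> x; exact: sin_max.
have E : p ^+ 2 + q ^+ 2 = \int[mu]_x (p * cos (t * x) + q * sin (t * x)).
  by rewrite RintegralD//; [rewrite !RintegralZl// !expr2|exact: L1Zl|exact: L1Zl].
have : p ^+ 2 + q ^+ 2 <= (p ^+ 2 + q ^+ 2 + 1) / 2.
  rewrite {1}E; have h := probability_setT mu.
  have <- : \int[mu]_x ((p ^+ 2 + q ^+ 2 + 1) / 2) = (p ^+ 2 + q ^+ 2 + 1) / 2.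
    by rewrite Rintegral_cst// [X in fine X]h mulr1.
  apply: le_Rintegral => //.
  - by apply: L1D; exact: L1Zl.
  - exact: finite_measure_integrable_cst.
  - move=> x _; have := cos2Dsin2 (t * x).
    have := sqr_ge0 (p - cos (t * x)); have := sqr_ge0 (q - sin (t * x)); nra.
by lra.
Qed.

End complex_exponential.

Section levy_khintchine.
Context {R : realType} d (T : measurableType d) (P : probability T R).
Variables (X : {RV P >-> R}) (b : R).
Variable nu : {measure set (measurableTypeR R) -> \bar R}.
Hypothesis hID : ID X b nu.
Hypothesis iX : P.-integrable [set: T] (EFin \o X).
Local Notation mu := (@lebesgue_measure R).
Local Notation psi := (psi nu).
Local Notation theta := (theta nu b).

Let levy : levy_measure nu. Proof. by case: hID. Qed.

Lemma ID_char_fun t : char_fun X t = cexp (Complex (- psi t) (theta t)).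
Proof.
case: hID => _ ->; congr cexp; apply/eqP; rewrite eq_complex/=.
apply/andP; split; apply/eqP.
  rewrite add0r /psi -[RHS]mulN1r -RintegralZl//; last exact: (L1_onemcos levy t).
  by apply: eq_Rintegral => u _; rewrite expR0; ring.
rewrite /theta; congr (_ + _).
by apply: eq_Rintegral => u _; rewrite expR0 /small; ring.
Qed.

Lemma ID_cos t : \int[P]_w cos (t * X w) = expR (- psi t) * cos (theta t).
Proof.
have := congr1 (@complex.Re R) (ID_char_fun t); rewrite /char_fun/= => <-.
by apply: eq_Rintegral => w _; rewrite expR0 mul1r.
Qed.

Lemma ID_sin t : \int[P]_w sin (t * X w) = expR (- psi t) * sin (theta t).
Proof.
have := congr1 (@complex.Im R) (ID_char_fun t); rewrite /char_fun/= => <-.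
by apply: eq_Rintegral => w _; rewrite expR0 mul1r.
Qed.

Lemma ID_L1_minsq :
  nu.-integrable [set: measurableTypeR R] (EFin \o (@minsq R)).
Proof.
apply: (L1_minsq levy iX) => t; rewrite ID_cos.
by rewrite -[leRHS]mulr1 ler_wpM2l ?expR_ge0// cos_le1.
Qed.

Let iminsq := ID_L1_minsq.

(** Both sides are the derivative at 0 of t -> E sin (t X): once under the expectation, once through
    exp (- psi) sin theta, where psi 0 = theta 0 = 0. *)
Lemma ID_mean : \int[P]_w X w = dtheta nu b 0.
Proof.
have mX := measurable_RV X.
have i1 : is_derive (0 : R) (1 : R) (fun t => \int[P]_w sin (t * X w))
    (\int[P]_w (X w * cos (0 * X w))).
  apply: (@is_derive_Rintegral _ _ R P (fun t w => sin (t * X w))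
    (fun t w => X w * cos (t * X w))).
  - exact: L1_sinRV.
  - by move=> s w; exact: is_derive_sinM.
  - move=> M; exists (fun w => `|X w|); first exact: L1_norm.
    by move=> s w _; rewrite normrM -[leRHS]mulr1 ler_wpM2l// cos_max.
have i2 : is_derive (0 : R) (1 : R) (fun t => \int[P]_w sin (t * X w))
    (dtheta nu b 0).
  rewrite (funext ID_sin).
  have j1 := is_derive_psi levy iminsq 0.
  have j2 := is_derive_theta b iminsq 0.
  have j3 : is_derive (0 : R) (1 : R) (fun t => expR (- psi t))
      (- dpsi nu 0 * expR (- psi 0)).
    apply: (@is_derive_compf _ expR (fun t => - psi t)); exact: is_deriveN.
  have j4 : is_derive (0 : R) (1 : R) (fun t => sin (theta t))
      (dtheta nu b 0 * cos (theta 0)).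
    exact: (@is_derive_compf _ sin theta).
  apply: is_derive_eq; rewrite /GRing.scale/= psi0 theta0 oppr0 expR0 sin0 cos0.
  by rewrite mul0r addr0 mul1r mulr1.
have [_ e1] := i1; have [_ e2] := i2; rewrite -e2 e1.
by apply: eq_Rintegral => w _; rewrite mul0r cos0 mulr1.
Qed.

Lemma char_fun_ratio xi c : char_fun X xi / char_fun X (c * xi) =
  cexp (Complex (psi (c * xi) - psi xi) (theta xi - theta (c * xi))).
Proof. by rewrite !ID_char_fun cexp_div opprK addrC. Qed.

(** The squared modulus of the ratio is exp (2 (psi (c xi) - psi xi)). Self-decomposability covers 0
    < c < 1; the endpoints are direct, and c = 0 is needed for Gamma 0. *)
Lemma self_decomposable_psi_le c xi : self_decomposable X ->
  0 <= c <= 1 -> psi (c * xi) <= psi xi.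
Proof.
move=> sdX /andP[]; rewrite le_eqVlt => /predU1P[<-|c0].
  by rewrite mul0r psi0 psi_ge0.
rewrite le_eqVlt => /predU1P[->|c1]; first by rewrite mul1r.
have /(is_char_fun_norm_le1 xi) := sdX c c0 c1.
rewrite char_fun_ratio/= !exprMn -mulrDr cos2Dsin2 mulr1 -expRM_natl.
rewrite expR_le1; lra.
Qed.

(** * The semigroup on a test function in real form *)

Section test_function.
Variable h : R -> R.

(** Convertible to [wave (cosT h xi) (sinT h xi) c x xi] below; later proofs pass from one to the
    other by conversion alone. *)
Definition interp (c x xi : R) : R :=
  expR (psi (c * xi) - psi xi) *
  (cosT h xi * cos (c * xi * x + (theta xi - theta (c * xi))) +
   sinT h xi * sin (c * xi * x + (theta xi - theta (c * xi)))).

Hypothesis ih : mu.-integrable [set: R] (EFin \o h).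

Lemma fourierE xi : fourier (fun y => real_complex _ (h y)) xi =
  Complex (cosT h xi) (- sinT h xi).
Proof.
rewrite /fourier /cintegral/=; congr Complex.
  by apply: eq_Rintegral => y _; rewrite expR0 cosN; ring.
rewrite /sinT -[RHS]mulN1r -RintegralZl//; last exact: L1_sinM.
by apply: eq_Rintegral => y _; rewrite expR0 sinN; ring.
Qed.

Lemma Re_semigroupE t x :
  complex.Re (semigroup (char_fun X) t (fun y => real_complex _ (h y)) x) =
  (2 * pi)^-1 * \int[mu]_xi interp (expR (- t)) x xi.
Proof.
have E xi : complex.Re (fourier (fun y => real_complex _ (h y)) xi *
    cexp (Complex 0 (xi * x * expR (- t))) *
    (char_fun X xi / char_fun X (expR (- t) * xi))) = interp (expR (- t)) x xi.
  rewrite char_fun_ratio fourierE cexp_im /interp.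
  move: (theta xi - _) => D; rewrite cosD sinD /=.
  have -> : xi * x * expR (- t) = expR (- t) * xi * x by ring.
  ring.
under [in RHS]eq_Rintegral => xi _ do rewrite -E.
rewrite /semigroup /cintegral.
by set I1 := \int[mu]_w complex.Re _; set I2 := \int[mu]_w complex.Im _;
  rewrite [LHS]/= mul0r subr0.
Qed.

Hypothesis icos : mu.-integrable [set: R] (EFin \o cosT h).
Hypothesis isin : mu.-integrable [set: R] (EFin \o sinT h).
Hypothesis ch : continuous h.
Hypothesis h1 : forall x, `|h x| <= 1.

Lemma Rintegral_interp1 x : \int[mu]_xi interp 1 x xi = 2 * pi * h x.
Proof.
rewrite -(fourier_inversion x ch h1 ih icos isin); apply: eq_Rintegral => xi _.
by rewrite /interp !mul1r !subrr addr0 expR0 mul1r.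
Qed.

(** At c = 0 the point [x] drops out and the integrand is cosT h xi E cos (xi X) + sinT h xi E sin
    (xi X). Fubini moves the expectation outside, where the inversion formula applies at each point
    [X w]. *)
Lemma Rintegral_interp0 x :
  (2 * pi)^-1 * \int[mu]_xi interp 0 x xi = \int[P]_w h (X w).
Proof.
have pi0 : 2 * pi != 0 :> R by rewrite mulf_neq0// gt_eqF// pi_gt0.
have mX := measurable_RV X.
pose f (p : T * measurableTypeR R) := cosT h p.2 * cos (p.2 * X p.1) +
  sinT h p.2 * sin (p.2 * X p.1).
have mf : measurable_fun [set: T * measurableTypeR R] f.
  have mX1 : measurable_fun [set: T * measurableTypeR R] (fun p => X p.1).
    exact: (measurableT_comp mX measurable_fst).
  have mp2 : measurable_fun [set: T * measurableTypeR R]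
      (fun p => p.2 * X p.1 : R).
    by apply: measurable_funM => //; exact: measurable_snd.
  apply: measurable_funD; apply: measurable_funM.
  - apply: (measurable_compR (measurable_L1 icos)); exact: measurable_snd.
  - exact: (measurable_compC (@continuous_cos R)).
  - apply: (measurable_compR (measurable_L1 isin)); exact: measurable_snd.
  - exact: (measurable_compC (@continuous_sin R)).
have i1 : P.-integrable [set: T] (EFin \o cst 1).
  exact: finite_measure_integrable_cst.
have i2 : mu.-integrable [set: measurableTypeR R]
    (EFin \o (fun xi => `|cosT h xi| + `|sinT h xi|)).
  by apply: L1D; exact: L1_norm.
have fb w xi : `|f (w, xi)| <= cst 1 w * (`|cosT h xi| + `|sinT h xi|).
  rewrite mul1r (le_trans (ler_normD _ _))// !normrM lerD//.
    by rewrite -[leRHS]mulr1 ler_wpM2l// cos_max.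
  by rewrite -[leRHS]mulr1 ler_wpM2l// sin_max.
have := RFubini mf i1 i2 fb; rewrite /f/= => F.
transitivity ((2 * pi)^-1 * \int[P]_w (2 * pi * h (X w))).
  congr (_ * _).
  under [in RHS]eq_Rintegral => w _ do
    rewrite -(fourier_inversion (X w) ch h1 ih icos isin).
  rewrite F; apply: eq_Rintegral => xi _.
  rewrite RintegralD//; last 2 first.
  - by apply: L1Zl; exact: L1_cosRV.
  - by apply: L1Zl; exact: L1_sinRV.
  rewrite RintegralZl//; last exact: L1_cosRV.
  rewrite RintegralZl//; last exact: L1_sinRV.
  rewrite ID_cos ID_sin /interp !mul0r psi0 theta0 sub0r subr0 add0r.
  ring.
rewrite RintegralZl ?mulKf//.
apply: (@L1_le _ _ R P _ (cst 1)) => //.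
exact: measurable_compC.
Qed.

End test_function.
End levy_khintchine.

(** * The integrand as a function of time and space *)

Section wave.
Context {R : realType}.
Variables (nu : {measure set (measurableTypeR R) -> \bar R}) (b : R).
Local Notation psi := (psi nu).
Local Notation theta := (theta nu b).
Local Notation dpsi := (dpsi nu).
Local Notation dtheta := (dtheta nu b).

Definition phase (c x xi : R) : R := c * xi * x + (theta xi - theta (c * xi)).

(** The amplitudes stay free because both shifting and differentiating in [x] bring in the quarter
    turn from (p, q) to (q, - p). *)
Definition wave (p q c x xi : R) : R :=
  expR (psi (c * xi) - psi xi) *
  (p * cos (phase c x xi) + q * sin (phase c x xi)).

Lemma wave_shift p q c x u xi : wave p q c (x + u) xi =
  wave p q c x xi * cos (c * xi * u) + wave q (- p) c x xi * sin (c * xi * u).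
Proof.
rewrite /wave (_ : phase c (x + u) xi = phase c x xi + c * xi * u).
  by rewrite cosD sinD; ring.
by rewrite /phase; ring.
Qed.

Lemma wave_opp p q c x xi : wave (- p) (- q) c x xi = - wave p q c x xi.
Proof. by rewrite /wave; ring. Qed.

Lemma norm_wave_le p q c x xi : psi (c * xi) <= psi xi ->
  `|wave p q c x xi| <= `|p| + `|q|.
Proof.
move=> pp; rewrite normrM (ger0_norm (expR_ge0 _)) -[leRHS]mul1r.
apply: ler_pM; [exact: expR_ge0|exact: normr_ge0| |].
  by rewrite expR_le1 subr_le0.
rewrite (le_trans (ler_normD _ _))// !normrM lerD//.
  by rewrite -[leRHS]mulr1 ler_wpM2l// cos_max.
by rewrite -[leRHS]mulr1 ler_wpM2l// sin_max.
Qed.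

Lemma is_derive_wave_x p q c xi (x : R) :
  is_derive x (1 : R) (fun x => wave p q c x xi)
    (c * xi * wave q (- p) c x xi).
Proof.
have j : is_derive x (1 : R) (fun x => phase c x xi) (c * xi).
  by rewrite /phase; apply: is_derive_eq; rewrite /GRing.scale/=; ring.
have jc := is_derive_compf (g := fun x => phase c x xi)
  (is_derive_cos (phase c x xi)) j.
have js := is_derive_compf (g := fun x => phase c x xi)
  (is_derive_sin (phase c x xi)) j.
by rewrite /wave; apply: is_derive_eq; rewrite /GRing.scale/=; ring.
Qed.

Hypothesis levy : levy_measure nu.
Hypothesis iminsq :
  nu.-integrable [set: measurableTypeR R] (EFin \o (@minsq R)).

(** The coefficients [dpsi (c * xi)] and [dtheta (c * xi)] are what integrating the jumps against
    [nu] produces, up to the value [dtheta 0]. This match is what makes the Stein equation hold. *)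
Lemma is_derive_wave_c p q x xi (c : R) :
  is_derive c (1 : R) (fun c => wave p q c x xi)
    (xi * (dpsi (c * xi) * wave p q c x xi +
           (x - dtheta (c * xi)) * wave q (- p) c x xi)).
Proof.
have jm := is_derive_mulr xi c.
have jt := is_derive_compf (g := fun c => c * xi)
  (is_derive_theta b iminsq (c * xi)) jm.
have jp := is_derive_compf (g := fun c => c * xi)
  (is_derive_psi levy iminsq (c * xi)) jm.
have j : is_derive c (1 : R) (fun c => phase c x xi)
    (xi * x - xi * dtheta (c * xi)).
  by rewrite /phase; apply: is_derive_eq; rewrite /GRing.scale/=; ring.
have jc := is_derive_compf (g := fun c => phase c x xi)
  (is_derive_cos (phase c x xi)) j.
have js := is_derive_compf (g := fun c => phase c x xi)
  (is_derive_sin (phase c x xi)) j.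
have je0 : is_derive c (1 : R) (fun c => psi (c * xi) - psi xi)
    (xi * dpsi (c * xi)).
  by apply: is_derive_eq; rewrite subr0.
have je := is_derive_compf (g := fun c => psi (c * xi) - psi xi)
  (is_derive_expR (psi (c * xi) - psi xi)) je0.
by rewrite /wave; apply: is_derive_eq; rewrite /GRing.scale/=; ring.
Qed.

Lemma continuous_wave_c p q x xi : continuous (fun c : R => wave p q c x xi).
Proof. exact: is_derive_continuous (is_derive_wave_c p q x xi). Qed.

Lemma measurable_wave d (Z : measurableType d) (p q c x xi : Z -> R) :
  measurable_fun [set: Z] p -> measurable_fun [set: Z] q ->
  measurable_fun [set: Z] c -> measurable_fun [set: Z] x ->
  measurable_fun [set: Z] xi ->
  measurable_fun [set: Z] (fun z => wave (p z) (q z) (c z) (x z) (xi z)).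
Proof.
move=> mp mq mc mx mxi; rewrite /wave.
have mcx : measurable_fun [set: Z] (fun z => c z * xi z) by exact: measurable_funM.
have cps := continuous_psi levy iminsq.
have cth := continuous_theta (b := b) iminsq.
have mph : measurable_fun [set: Z] (fun z => phase (c z) (x z) (xi z)).
  apply: measurable_funD; first exact: measurable_funM.
  apply: measurable_funB; first exact: (measurable_compC cth).
  exact: (measurable_compC cth mcx).
apply: measurable_funM.
  apply: (measurable_compC (@continuous_expR R)).
  apply: measurable_funB; first exact: (measurable_compC cps mcx).
  exact: (measurable_compC cps).
apply: measurable_funD; apply: measurable_funM => //.
  exact: (measurable_compC (@continuous_cos R)).
exact: (measurable_compC (@continuous_sin R)).
Qed.

(** Since |c xi| <= |xi|, the bound is uniform in [c]. The constants 3 and 2 collect (1 + |xi|) L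
    from [dpsi] and (2 + |xi|) L from the increment of [dtheta], L being the integral of [minsq]. *)
Lemma norm_derive_wave_c_le p q x xi c : 0 <= c <= 1 ->
  psi (c * xi) <= psi xi ->
  `|xi * (dpsi (c * xi) * wave p q c x xi +
           (x - dtheta (c * xi)) * wave q (- p) c x xi)| <=
  `|xi| * (`|p| + `|q|) * (`|x| + `|dtheta 0| + 3 * \int[nu]_u minsq u
     + 2 * (\int[nu]_u minsq u) * `|xi|).
Proof.
move=> /andP[c0 c1] pp; set L := \int[nu]_u minsq u.
have L0 : 0 <= L by apply: Rintegral_ge0 => u _; exact: minsq_ge0.
have W1 := norm_wave_le p q x pp; have W2 := norm_wave_le q (- p) x pp.
rewrite normrN addrC in W2.
have s1 : `|c * xi| <= `|xi| by rewrite normrM (ger0_norm c0) ler_piMl.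
have D1 : `|dpsi (c * xi)| <= (1 + `|xi|) * L.
  by rewrite (le_trans (norm_dpsi_le iminsq _))// ler_wpM2r// lerD2l.
have D2 : `|x - dtheta (c * xi)| <= `|x| + `|dtheta 0| + (2 + `|xi|) * L.
  have -> : x - dtheta (c * xi) = x - dtheta 0 - (dtheta (c * xi) - dtheta 0) by ring.
  rewrite (le_trans (ler_normB _ _))// lerD ?ler_normB//.
  by rewrite (le_trans (norm_dthetaB_le b iminsq _))// ler_wpM2r// lerD2l.
rewrite normrM -mulrA ler_wpM2l// (le_trans (ler_normD _ _))//.
rewrite (normrM (dpsi _)) (normrM (x - _)).
have -> : (`|p| + `|q|) * (`|x| + `|dtheta 0| + 3 * L + 2 * L * `|xi|) =
    (1 + `|xi|) * L * (`|p| + `|q|) +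
    (`|x| + `|dtheta 0| + (2 + `|xi|) * L) * (`|p| + `|q|) by ring.
by rewrite lerD// ler_pM.
Qed.

End wave.

(** * The Stein equation *)

Section stein_equation.
Context {R : realType} d (T : measurableType d) (P : probability T R).
Variables (X : {RV P >-> R}) (b : R).
Variable nu : {measure set (measurableTypeR R) -> \bar R}.
Variables (h : R -> R) (K : R).
Hypothesis hID : ID X b nu.
Hypothesis iX : P.-integrable [set: T] (EFin \o X).
Hypothesis sdX : self_decomposable X.
Local Notation mu := (@lebesgue_measure R).
Local Notation RR := (measurableTypeR R).
Local Notation psi := (psi nu).
Local Notation theta := (theta nu b).
Local Notation wave := (wave nu b).
Local Notation dtheta := (dtheta nu b).
Local Notation dpsi := (dpsi nu).
Hypothesis ch : continuous h.
Hypothesis h1 : forall x, `|h x| <= 1.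
Hypothesis ih : mu.-integrable [set: R] (EFin \o h).
Hypothesis K0 : 0 <= K.
Hypothesis decay : forall xi, `|cosT h xi| <= K / (1 + xi ^+ 2) ^+ 2 /\
  `|sinT h xi| <= K / (1 + xi ^+ 2) ^+ 2.

Let levy : levy_measure nu. Proof. by case: hID. Qed.
Let iminsq := ID_L1_minsq hID iX.
Let L := \int[nu]_u minsq u.

Let L0 : 0 <= L.
Proof. by apply: Rintegral_ge0 => u _; exact: minsq_ge0. Qed.

Local Notation A := (cosT h).
Local Notation S := (sinT h).

(** The amplitude that [norm_wave_le] gives for the transforms of [h]. *)
Let W (xi : R) : R := `|A xi| + `|S xi|.

Let W0 xi : 0 <= W xi. Proof. by rewrite /W addr_ge0. Qed.

Let weight_le (xi v C : R) : 0 <= v -> v <= C * (1 + xi ^+ 2) ->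
  W xi * v <= 2 * K * C * (1 + xi ^+ 2)^-1.
Proof.
move=> v0 vC; have [d1 d2] := decay xi.
have p : 0 < 1 + xi ^+ 2 by rewrite ltr_pwDl// sqr_ge0.
have Wle : W xi <= 2 * K / (1 + xi ^+ 2) ^+ 2.
  by rewrite -mulrA mulr_natl mulr2n; exact: lerD.
apply: (@le_trans _ _ (2 * K / (1 + xi ^+ 2) ^+ 2 * (C * (1 + xi ^+ 2)))).
  exact: ler_pM.
rewrite le_eqVlt; apply/orP; left; apply/eqP; field.
by rewrite gt_eqF.
Qed.

Let norm_weight_le (xi a c : R) : 0 <= a -> 0 <= c ->
  `|xi| * W xi * (a + c * `|xi|) <= 2 * K * (a + c) * (1 + xi ^+ 2)^-1.
Proof.
move=> a0 c0; rewrite mulrAC mulrC; have x0 := normr_ge0 xi.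
apply: weight_le; first by rewrite mulr_ge0// addr_ge0// mulr_ge0.
rewrite -(real_normK (num_real xi)); have := sqr_ge0 (`|xi| - 1); nra.
Qed.

Let L1_inv (C : R) : mu.-integrable [set: R] (EFin \o (fun xi => C * (1 + xi ^+ 2)^-1)).
Proof. exact: L1Zl (@integrable_oneDsqrV R).1. Qed.

Let L1_W_le (f : R -> R) : measurable_fun [set: R] f ->
  (forall xi, `|f xi| <= W xi) -> mu.-integrable [set: R] (EFin \o f).
Proof.
move=> mf fW; apply: (@L1_le _ _ R mu _ (fun xi => 2 * K * 1 * (1 + xi ^+ 2)^-1)) => //.
  move=> xi; rewrite (le_trans (fW xi))// -[leLHS]mulr1; apply: weight_le => //.
  by rewrite mul1r lerDl sqr_ge0.
Qed.

Let cA : continuous A := continuous_cosT ih.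
Let cS : continuous S := continuous_sinT ih.
Let mA : measurable_fun [set: R] A. Proof. exact: continuous_measurable_fun. Qed.
Let mS : measurable_fun [set: R] S. Proof. exact: continuous_measurable_fun. Qed.

Let iA : mu.-integrable [set: R] (EFin \o A).
Proof. by apply: L1_W_le => // xi; rewrite lerDl. Qed.

Let iS : mu.-integrable [set: R] (EFin \o S).
Proof. by apply: L1_W_le => // xi; rewrite lerDr. Qed.

Let psi_le (c xi : R) : 0 <= c <= 1 -> psi (c * xi) <= psi xi.
Proof. exact: self_decomposable_psi_le hID _ _ sdX. Qed.

Let expR_itv (t : R) : 0 <= t -> 0 <= expR (- t) <= 1.
Proof. by move=> t0; rewrite expR_ge0 expR_le1 oppr_le0. Qed.

(** The restriction to t >= 0 is put into the integrands, so that product measures and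
    differentiation under the integral live on the whole plane. *)
Let chi (t : R) : R := if 0 <= t then 1 else 0.
Let wt (t : R) : R := chi t * expR (- t).
(** The common dominating function in time and frequency; only the constant [C] changes from one
    integrand to the next. *)
Let bnd (C : R) (z : RR * RR) : R := wt z.1 * (C * (1 + z.2 ^+ 2)^-1).

Let mchi : measurable_fun [set: R] chi.
Proof. by apply: measurable_fun_ifT => //; exact: measurable_fun_ler. Qed.

Let chi_ge0 t : 0 <= chi t. Proof. by rewrite /chi; case: ifP. Qed.

Let wt_ge0 t : 0 <= wt t. Proof. by rewrite mulr_ge0// expR_ge0. Qed.

Let mexpN : measurable_fun [set: R] (fun t : R => expR (- t)).
Proof. exact: (measurable_compC (@continuous_expR R)). Qed.

Let mwt : measurable_fun [set: R] wt.
Proof. exact: measurable_funM. Qed.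

Let L1_wt : mu.-integrable [set: R] (EFin \o wt).
Proof.
apply: (@L1_le _ _ R mu _ (fun t => expR (- (1 * `|t|)))) => //.
  move=> t; rewrite (ger0_norm (wt_ge0 t)) mul1r /wt /chi; case: ifPn => t0.
    by rewrite mul1r ger0_norm.
  by rewrite mul0r expR_ge0.
exact: integrable_expMnorm.
Qed.

Let bnd_ge0 C z : 0 <= C -> 0 <= bnd C z.
Proof.
by move=> C0; rewrite mulr_ge0// mulr_ge0// invr_ge0 addr_ge0// sqr_ge0.
Qed.

Let L1_bnd C : 0 <= C ->
  (mu \x mu)%E.-integrable [set: RR * RR] (EFin \o bnd C).
Proof.
move=> C0; apply: (@L1_prod _ _ _ _ R mu mu _ wt (fun xi => C * (1 + xi ^+ 2)^-1)) => //.
  apply: measurable_funM; first by apply: (measurable_compR mwt); exact: measurable_fst.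
  apply: (measurable_compR (measurable_L1 (L1_inv C))); exact: measurable_snd.
by move=> x y; rewrite ger0_norm// bnd_ge0.
Qed.

Definition kern (x : R) (z : RR * RR) : R :=
  chi z.1 * (wave (A z.2) (S z.2) (expR (- z.1)) x z.2
             - wave (A z.2) (S z.2) 0 x z.2).

Definition slope (x : R) (z : RR * RR) : R :=
  chi z.1 * (expR (- z.1) * z.2 * wave (S z.2) (- A z.2) (expR (- z.1)) x z.2).

Lemma measurable_kern (x : R) : measurable_fun [set: RR * RR] (kern x).
Proof.
have m1 : measurable_fun [set: RR * RR] (fun z => z.1 : R) by exact: measurable_fst.
have m2 : measurable_fun [set: RR * RR] (fun z => z.2 : R) by exact: measurable_snd.
have mA2 := measurable_compR mA m2; have mS2 := measurable_compR mS m2.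
apply: measurable_funM; first exact: measurable_compR mchi m1.
apply: measurable_funB; apply: measurable_wave => //.
exact: measurable_compR mexpN m1.
Qed.

Lemma measurable_slope d' (Z : measurableType d') (x : Z -> R) (z : Z -> RR * RR) :
  measurable_fun [set: Z] x -> measurable_fun [set: Z] z ->
  measurable_fun [set: Z] (fun y => slope (x y) (z y)).
Proof.
move=> mx mz.
have m1 : measurable_fun [set: Z] (fun y => (z y).1 : R).
  exact: (measurableT_comp measurable_fst mz).
have m2 : measurable_fun [set: Z] (fun y => (z y).2 : R).
  exact: (measurableT_comp measurable_snd mz).
have mA2 := measurable_compR mA m2; have mS2 := measurable_compR mS m2.
have me := measurable_compR mexpN m1.
apply: measurable_funM; first exact: measurable_compR mchi m1.
apply: measurable_funM; first exact: measurable_funM.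
by apply: measurable_wave => //; exact: measurableT_comp.
Qed.

(** The constant that [norm_weight_le] returns for the bound of [norm_derive_wave_c_le]. *)
Let Cx (x : R) := 2 * K * ((`|x| + `|dtheta 0| + 3 * L) + 2 * L).

Let Cx_ge0 x : 0 <= Cx x.
Proof. by rewrite !mulr_ge0// !addr_ge0// mulr_ge0. Qed.

(** The derivative of [wave] in [c], taken at c = exp (- t). *)
Let drift (x : R) (z : RR * RR) : R :=
  z.2 * (dpsi (expR (- z.1) * z.2) * wave (A z.2) (S z.2) (expR (- z.1)) x z.2
    + (x - dtheta (expR (- z.1) * z.2)) *
      wave (S z.2) (- A z.2) (expR (- z.1)) x z.2).

(** Mean value theorem in [c] on [0, exp (- t)]: the length of the interval supplies the decay in
    time that makes the integral defining f_h converge. *)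
Lemma norm_kern_le x z : `|kern x z| <= bnd (Cx x) z.
Proof.
case: z => t xi; rewrite /kern /bnd /wt /chi/=; case: ifPn => [t0|_]; last first.
  by rewrite !mul0r normr0.
rewrite !mul1r; have /andP[e0 e1] := expR_itv t0.
apply: (le_trans (MVT_norm_le e0
  (fun c => is_derive_wave_c b levy iminsq (A xi) (S xi) x xi c) _)).
  move=> c /andP[c0 ce]; have c1 : 0 <= c <= 1 by rewrite c0 (le_trans ce).
  apply: (le_trans (norm_derive_wave_c_le b iminsq (A xi) (S xi) x c1 (psi_le xi c1))).
  apply: norm_weight_le; first by rewrite !addr_ge0// mulr_ge0.
  by rewrite mulr_ge0.
by rewrite subr0 mulrC.
Qed.

(** The factor exp (- t) comes from the chain rule. The bound does not involve [x], so a single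
    function dominates at all points. *)
Lemma norm_slope_le x z : `|slope x z| <= bnd (2 * K) z.
Proof.
case: z => t xi; rewrite /slope /bnd /wt /chi/=; case: ifPn => [t0|_]; last first.
  by rewrite !mul0r normr0.
rewrite !mul1r -mulrA normrM (ger0_norm (expR_ge0 _)) ler_wpM2l ?expR_ge0//.
rewrite normrM; have pp := psi_le xi (expR_itv t0).
apply: (@le_trans _ _ (`|xi| * W xi)).
  rewrite ler_wpM2l// (le_trans (norm_wave_le b (S xi) (- A xi) x pp))//.
  by rewrite normrN addrC.
have := norm_weight_le xi ler01 (lexx 0).
by rewrite mul0r !addr0 !mulr1.
Qed.

(** The term at c = 0 has a phase free of [x] and contributes no derivative. *)
Lemma is_derive_kern z (x : R) :
  is_derive x (1 : R) (fun x => kern x z) (slope x z).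
Proof.
have j1 := is_derive_wave_x nu b (A z.2) (S z.2) (expR (- z.1)) z.2 x.
have j2 := is_derive_wave_x nu b (A z.2) (S z.2) 0 z.2 x.
by rewrite /kern; apply: is_derive_eq; rewrite /GRing.scale/= /slope; ring.
Qed.

Lemma L1_kern x : (mu \x mu)%E.-integrable [set: RR * RR] (EFin \o kern x).
Proof.
apply: (@L1_le _ _ R (mu \x mu)%E _ (bnd (Cx x))); first exact: measurable_kern.
  exact: norm_kern_le.
exact: L1_bnd.
Qed.

Lemma L1_slope x : (mu \x mu)%E.-integrable [set: RR * RR] (EFin \o slope x).
Proof.
apply: (@L1_le _ _ R (mu \x mu)%E _ (bnd (2 * K))).
- by apply: (measurable_slope (x := fun=> x) (z := id)) => //; exact: measurable_id.
- exact: norm_slope_le.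
- by apply: L1_bnd; rewrite mulr_ge0.
Qed.

Lemma L1_wave c x : 0 <= c <= 1 ->
  mu.-integrable [set: R] (EFin \o (fun xi => wave (A xi) (S xi) c x xi)).
Proof.
move=> c01; apply: L1_W_le.
  by apply: measurable_wave => //; exact: measurable_cst.
by move=> xi; apply: norm_wave_le; exact: psi_le.
Qed.

Lemma stein_solutionE x :
  stein_solution X h x = - ((2 * pi)^-1 * \int[(mu \x mu)%E]_z kern x z).
Proof.
have fb t xi : `|kern x (t, xi)| <= wt t * (Cx x * (1 + xi ^+ 2)^-1).
  exact: norm_kern_le.
have mk := measurable_kern x; have ix := L1_inv (Cx x).
rewrite -(Rintegral12 mk L1_wt ix fb) -RintegralZl//; last first.
  exact: (L1_Rintegral1 mk L1_wt ix fb).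
rewrite /stein_solution Rintegral_mkcond; congr (- _).
apply: eq_Rintegral => t _; rewrite /patch; case: ifPn => [|]; last first.
  rewrite notin_setE /= in_itv/= andbT => /negP/negbTE t0.
  rewrite /kern /chi/= t0; under eq_Rintegral do rewrite mul0r.
  by rewrite /Rintegral integral0 mulr0.
move=> ti; have t0 : 0 <= t by move: ti; rewrite inE/= in_itv/= andbT.
rewrite (Re_semigroupE hID ih) -(Rintegral_interp0 hID ih iA iS ch h1 x) -mulrBr.
congr (_ * _); rewrite -RintegralB//.
- by apply: eq_Rintegral => xi _; rewrite /kern /chi/= t0 mul1r.
- by apply: L1_wave; exact: expR_itv.
- by apply: L1_wave; rewrite lexx ler01.
Qed.

Lemma is_derive_stein_solution (x : R) : is_derive x (1 : R)
  (stein_solution X h) (- ((2 * pi)^-1 * \int[(mu \x mu)%E]_z slope x z)).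
Proof.
rewrite (funext stein_solutionE).
have j : is_derive x (1 : R) (fun x => \int[(mu \x mu)%E]_z kern x z)
    (\int[(mu \x mu)%E]_z slope x z).
  apply: (@is_derive_Rintegral _ _ R (mu \x mu)%E kern slope).
  - exact: L1_kern.
  - by move=> y z; exact: is_derive_kern.
  - move=> M; exists (bnd (2 * K)); first by apply: L1_bnd; rewrite mulr_ge0.
    by move=> y z _; exact: norm_slope_le.
exact: is_deriveN.
Qed.

Lemma derive1_stein_solution (x : R) : derive1 (stein_solution X h) x =
  - ((2 * pi)^-1 * \int[(mu \x mu)%E]_z slope x z).
Proof. by rewrite derive1E; have [_] := is_derive_stein_solution x. Qed.

(** * The jump part and the Stein operator under the integral *)

Hypothesis nu_sf : sigma_finite [set: RR] nu.

Let snu : {sigma_finite_measure set RR -> \bar R} :=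
  sigma_finite_copy nu_sf.

Let smu : {sigma_finite_measure set (RR * RR)%type -> \bar R} :=
  sigma_finite_copy (product_sigma_finite mu mu).

Let jump (x : R) (p : RR * (RR * RR)) : R :=
  p.1 * (slope (x + p.1) p.2 - slope x p.2).

Let mjump x : measurable_fun [set: RR * (RR * RR)] (jump x).
Proof.
have m1 : measurable_fun [set: RR * (RR * RR)] (fun p => p.1 : R).
  exact: measurable_fst.
apply: measurable_funM => //; apply: measurable_funB.
  apply: (measurable_slope (x := fun p => x + p.1) (z := snd)) => //.
  exact: measurable_funD.
exact: (measurable_slope (x := fun=> x) (z := snd)).
Qed.

(** The angle addition formulas isolate the dependence on [u] in two factors whose [nu]-integrals,
    at s = exp (- t) xi, are [dtheta s - dtheta 0] and [dpsi s]. *)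
Let jumpE x u t xi : jump x (u, (t, xi)) =
  chi t * (expR (- t) * xi *
   (wave (S xi) (- A xi) (expR (- t)) x xi * (u * (cos (expR (- t) * xi * u) - 1))
    - wave (A xi) (S xi) (expR (- t)) x xi * (u * sin (expR (- t) * xi * u)))).
Proof.
by rewrite /jump /slope/= wave_shift wave_opp; ring.
Qed.

(** The two terms of [jumpE] carry (2 + |xi|) and (1 + |xi|) times [minsq u], together 3 + 2 |xi|;
    [norm_weight_le] turns this into 2 K (3 + 2) = 10 K. *)
Let norm_jump_le x u z : `|jump x (u, z)| <= minsq u * bnd (10 * K) z.
Proof.
case: z => t xi; rewrite jumpE /bnd /wt /chi/=; case: ifPn => [t0|_]; last first.
  by rewrite !mul0r mulr0 normr0.
rewrite !mul1r; have c01 := expR_itv t0; have pp := psi_le xi c01.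
have s1 : `|expR (- t) * xi| <= `|xi|.
  by rewrite normrM (ger0_norm (expR_ge0 _)) ler_piMl//; case/andP: c01.
rewrite -mulrA normrM (ger0_norm (expR_ge0 _)) [leRHS]mulrCA ler_wpM2l ?expR_ge0//.
rewrite normrM; set s := expR (- t) * xi in s1 *.
apply: (@le_trans _ _ (`|xi| * (W xi * ((3 + 2 * `|xi|) * minsq u)))).
  rewrite ler_wpM2l//.
  have w1 := norm_wave_le b (S xi) (- A xi) x pp; rewrite normrN addrC in w1.
  have w2 := norm_wave_le b (A xi) (S xi) x pp.
  have c1 := norm_mul_cosB1_le s u; have c2 := norm_mul_sin_le s u.
  have k0 := minsq_ge0 u; rewrite (le_trans (ler_normB _ _))//.
  have -> : W xi * ((3 + 2 * `|xi|) * minsq u) =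
      W xi * ((2 + `|xi|) * minsq u) + W xi * ((1 + `|xi|) * minsq u) by ring.
  rewrite lerD//.
    rewrite (normrM (wave _ _ _ _ _) (u * (_ - 1))) ler_pM//.
    by rewrite (le_trans c1)// ler_wpM2r// lerD2l.
  rewrite (normrM (wave _ _ _ _ _) (u * sin _)) ler_pM//.
  by rewrite (le_trans c2)// ler_wpM2r// lerD2l.
have -> : `|xi| * (W xi * ((3 + 2 * `|xi|) * minsq u)) =
    minsq u * (`|xi| * W xi * (3 + 2 * `|xi|)) by ring.
rewrite ler_wpM2l ?minsq_ge0//.
apply: (le_trans (norm_weight_le xi _ _)) => //.
by rewrite ler_wpM2r ?invr_ge0 ?addr_ge0 ?sqr_ge0//; lra.
Qed.

Let tdrift (x : R) (z : RR * RR) : R := chi z.1 * (- expR (- z.1) * drift x z).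

(** The Stein equation before integration over (t, xi): the jump part is the time derivative of
    Gamma (e^(-t)), cut off to t >= 0, minus the drift part (E X - x) times [slope]. *)
Let Rintegral_jump x z : \int[nu]_u jump x (u, z) =
  tdrift x z - (dtheta 0 - x) * slope x z.
Proof.
case: z => t xi; under eq_Rintegral do rewrite jumpE.
set s := expR (- t) * xi.
have i1 := L1_mul_cosB1 iminsq s; have i2 := L1_mul_sin iminsq s.
rewrite RintegralZl//; last by apply: L1Zl; apply: L1B; exact: L1Zl.
rewrite RintegralZl//; last by apply: L1B; exact: L1Zl.
rewrite RintegralB//; [|exact: L1Zl|exact: L1Zl].
rewrite RintegralZl// RintegralZl// -(dthetaB b iminsq) -/(dpsi s).
rewrite /tdrift /drift /slope/= -/s /s; ring.
Qed.

Let continuous_expN : continuous (fun t : R => expR (- t)).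
Proof.
apply: (@continuous_compf _ expR (fun t => - t)); first exact: continuous_expR.
by move=> t; apply: cvgN; exact: cvg_id.
Qed.

Let continuous_wave_t p q x xi :
  continuous (fun t : R => wave p q (expR (- t)) x xi).
Proof.
apply: (@continuous_compf _ (fun c => wave p q c x xi) (fun t => expR (- t))).
  exact: continuous_wave_c.
exact: continuous_expN.
Qed.

Let continuous_drift_t x xi :
  continuous (fun t : R => - expR (- t) * drift x (t, xi)).
Proof.
have cc (r : R) : continuous (fun _ : R => r) by move=> ?; exact: cvg_cst.
have cs : continuous (fun t : R => expR (- t) * xi).
  by apply: continuousMf => //; exact: continuous_expN.
have cd := continuous_dtheta (b := b) iminsq.
rewrite /drift/=.
apply: continuousMf; first by move=> t; apply: cvgN; exact: continuous_expN.
apply: continuousMf => //; apply: continuousDf; apply: continuousMf.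
- by apply: (@continuous_compf _ dpsi _ _ cs); exact: continuous_dpsi.
- exact: continuous_wave_t.
- move=> t; apply: cvgB; first exact: cvg_cst.
  exact: (@continuous_compf _ dtheta _ cd cs).
- exact: continuous_wave_t.
Qed.

Let norm_tdrift_le x z : `|tdrift x z| <= bnd (Cx x) z.
Proof.
case: z => t xi; rewrite /tdrift /bnd /wt /chi/=; case: ifPn => [t0|_]; last first.
  by rewrite !mul0r normr0.
rewrite !mul1r mulNr normrN normrM (ger0_norm (expR_ge0 _)) ler_wpM2l ?expR_ge0//.
have c01 := expR_itv t0.
apply: (le_trans (norm_derive_wave_c_le b iminsq (A xi) (S xi) x c01 (psi_le xi c01))).
by apply: norm_weight_le; rewrite ?mulr_ge0// !addr_ge0// mulr_ge0.
Qed.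

Let mtdrift x : measurable_fun [set: RR * RR] (tdrift x).
Proof.
have m1 : measurable_fun [set: RR * RR] (fun z => z.1 : R) by exact: measurable_fst.
have m2 : measurable_fun [set: RR * RR] (fun z => z.2 : R) by exact: measurable_snd.
have mA2 := measurable_compR mA m2; have mS2 := measurable_compR mS m2.
have me := measurable_compR mexpN m1; have mc := measurable_compR mchi m1.
have ms : measurable_fun [set: RR * RR] (fun z => expR (- z.1) * z.2 : R).
  exact: measurable_funM.
apply: measurable_funM => //; apply: measurable_funM.
  exact: measurableT_comp.
apply: measurable_funM => //; apply: measurable_funD; apply: measurable_funM.
- exact: (measurable_compC (continuous_dpsi iminsq)).
- exact: measurable_wave.
- apply: measurable_funB => //.
  exact: (measurable_compC (continuous_dtheta (b := b) iminsq)).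
- by apply: measurable_wave => //; exact: measurableT_comp.
Qed.

Let Rintegral_tdrift_t x xi : \int[mu]_t tdrift x (t, xi) =
  wave (A xi) (S xi) 0 x xi - wave (A xi) (S xi) 1 x xi.
Proof.
pose F t := wave (A xi) (S xi) (expR (- t)) x xi.
pose C := Cx x * (1 + xi ^+ 2)^-1.
have FE (t : R) : is_derive t (1 : R) F (- expR (- t) * drift x (t, xi)).
  have j : is_derive t (1 : R) (fun t => expR (- t)) (- expR (- t)).
    have := is_derive_expM 1 t; rewrite mul1r mulN1r.
    by under eq_fun do rewrite mul1r.
  rewrite /F /drift/=.
  apply: (@is_derive_compf _ (fun c => wave (A xi) (S xi) c x xi)
    (fun t => expR (- t))) => //.
  exact: is_derive_wave_c.
(* [dominated_FTC2y] asks for a primitive of the dominating function as well. *)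
have GE (t : R) : is_derive t (1 : R) (fun t => - C * expR (- t)) (C * expR (- t)).
  have j : is_derive t (1 : R) (fun t => expR (- t)) (- expR (- t)).
    have := is_derive_expM 1 t; rewrite mul1r mulN1r.
    by under eq_fun do rewrite mul1r.
  by apply: is_derive_eq; rewrite /GRing.scale/=; ring.
have e0 : expR (- t) @[t --> +oo] --> (0 : R).
  by have := cvgy_expRM (@ltr01 R); under eq_fun do rewrite mul1r.
have Fl : F t @[t --> +oo] --> wave (A xi) (S xi) 0 x xi.
  have cw := @continuous_wave_c _ _ b levy iminsq (A xi) (S xi) x xi.
  exact: cvg_comp e0 (cw 0).
have Gl : - C * expR (- t) @[t --> +oo] --> (0 : R).
  by rewrite -(mulr0 (- C)); apply: cvgMr.
have fg t : 0 <= t -> `|- expR (- t) * drift x (t, xi)| <= C * expR (- t).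
  move=> t0; have := norm_tdrift_le x (t, xi).
  by rewrite /tdrift /bnd /wt /chi/= t0 !mul1r (mulrC C).
have cg : continuous (fun t : R => C * expR (- t)).
  by apply: continuousMf; [move=> ?; exact: cvg_cst|exact: continuous_expN].
have [_] := dominated_FTC2y (@continuous_drift_t x xi) cg fg FE GE Fl Gl.
rewrite /F oppr0 expR0 => <-; rewrite [RHS]Rintegral_mkcond.
apply: eq_Rintegral => t _; rewrite /tdrift /patch /chi /=.
case: ifPn => [t0|t0].
  by rewrite mul1r mem_set//= in_itv/= t0.
by rewrite mul0r memNset//= in_itv/= andbT; exact/negP.
Qed.

(** Time is integrated first, in the order opposite to [stein_solutionE]. For each [xi] only the
    values at c = 0 and c = 1 survive, and their [xi]-integrals are 2 pi E h(X) and 2 pi h x. *)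
Lemma Rintegral_tdrift x : \int[(mu \x mu)%E]_z tdrift x z =
  2 * pi * (\int[P]_w h (X w) - h x).
Proof.
have fb t xi : `|tdrift x (t, xi)| <= wt t * (Cx x * (1 + xi ^+ 2)^-1).
  exact: norm_tdrift_le.
rewrite -(Rintegral21 (mtdrift x) L1_wt (L1_inv (Cx x)) fb).
under eq_Rintegral do rewrite Rintegral_tdrift_t.
rewrite RintegralB//; last 2 first.
- by apply: L1_wave; rewrite lexx ler01.
- by apply: L1_wave; rewrite lexx ler01.
rewrite (Rintegral_interp1 b nu ih iA iS ch h1 x).
rewrite -(Rintegral_interp0 hID ih iA iS ch h1 x).
by rewrite mulrBr mulVKf// mulf_neq0// gt_eqF// pi_gt0.
Qed.

Lemma stein_equation x :
  nu.-integrable [set: RR] (fun u : R => ((derive1 (stein_solution X h) (x + u)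
     - derive1 (stein_solution X h) x) * u)%:E) /\
  (\int[P]_w X w - x) * derive1 (stein_solution X h) x
  + \int[nu]_u ((derive1 (stein_solution X h) (x + u)
     - derive1 (stein_solution X h) x) * u)
  = h x - \int[P]_w h (X w).
Proof.
have ib : (mu \x mu)%E.-integrable [set: RR * RR] (EFin \o bnd (10 * K)).
  by apply: L1_bnd; rewrite mulr_ge0.
have fb u z : `|jump x (u, z)| <= minsq u * bnd (10 * K) z by exact: norm_jump_le.
(* Fubini is applied to the copies [snu] and [smu]; its conclusions hold for [nu] and the product
   measure by conversion. *)
have iJ : nu.-integrable [set: RR]
    (EFin \o (fun u => \int[(mu \x mu)%E]_z jump x (u, z))).
  exact (@L1_Rintegral1 _ _ _ _ R snu smu _ _ _ (mjump x) iminsq ib fb).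
have iJ2 : (mu \x mu)%E.-integrable [set: RR * RR]
    (EFin \o (fun z => \int[nu]_u jump x (u, z))).
  exact (@L1_Rintegral2 _ _ _ _ R snu smu _ _ _ (mjump x) iminsq ib fb).
have FJ : \int[nu]_u \int[(mu \x mu)%E]_z jump x (u, z) =
    \int[(mu \x mu)%E]_z \int[nu]_u jump x (u, z).
  exact (@RFubini _ _ _ _ R snu smu _ _ _ (mjump x) iminsq ib fb).
have E u : (derive1 (stein_solution X h) (x + u) - derive1 (stein_solution X h) x) * u
    = - (2 * pi)^-1 * \int[(mu \x mu)%E]_z jump x (u, z).
  rewrite /jump/= RintegralZl//; last by apply: L1B; exact: L1_slope.
  by rewrite RintegralB//; [rewrite !derive1_stein_solution; ring|exact: L1_slope..].
split.
  under eq_fun do rewrite E.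
  exact: L1Zl iJ.
rewrite (_ : \int[nu]_u _ =
    \int[nu]_u (- (2 * pi)^-1 * \int[(mu \x mu)%E]_z jump x (u, z))); last first.
  by apply: eq_Rintegral => u _; exact: E.
rewrite RintegralZl// FJ (ID_mean hID iX) derive1_stein_solution.
rewrite (_ : \int[(mu \x mu)%E]_z \int[nu]_u jump x (u, z) =
    \int[(mu \x mu)%E]_z (tdrift x z - (dtheta 0 - x) * slope x z)); last first.
  by apply: eq_Rintegral => z _; exact: Rintegral_jump.
have fb2 t xi : `|tdrift x (t, xi)| <= wt t * (Cx x * (1 + xi ^+ 2)^-1).
  exact: norm_tdrift_le.
rewrite RintegralB//; last 2 first.
- exact: (L1_prod (mtdrift x) L1_wt (L1_inv (Cx x)) fb2).
- exact: L1Zl (L1_slope x).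
rewrite RintegralZl//; last exact: L1_slope.
(* The two occurrences of (E X - x) times the integral of [slope] cancel, which leaves - (2 pi)^-1
   times 2 pi (E h(X) - h x). *)
rewrite Rintegral_tdrift; set I := \int[_]_z slope x z; set E0 := \int[P]_w h (X w).
have p0 : pi != 0 :> R by rewrite gt_eqF// pi_gt0.
move: I E0 (dtheta 0) (h x) (@pi R) p0 => i e m y q q0.
by field.
Qed.

End stein_equation.

(** The real-valued integral defaults to 0 when the extended one is infinite. The integrability
    conjunct certifies that the integral against [nu] in the equation is a genuine one. *)
Theorem lemma5p4 (R : realType) (d : measure_display) (T : measurableType d)
    (P : probability T R) (X : {RV P >-> R}) (b : R)
    (nu : {measure set (measurableTypeR R) -> \bar R}) (h : R -> R)
    (hID : ID X b nu)
    (hnd : nondegenerate_rv X)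
    (hsd : self_decomposable X)
    (hX : P.-integrable [set: T] (EFin \o X))
    (hh : smooth_compact_support h)
    (hh0 : forall x : R, `|h x| <= 1)
    (hh1 : forall x : R, `|derive1 h x| <= 1)
    (hh2 : forall x : R, `|derive1n 2 h x| <= 1) :
  let f := stein_solution X h in
  forall x : R,
    nu.-integrable [set: measurableTypeR R]
      (fun u : R => ((derive1 f (x + u) - derive1 f x) * u)%:E) /\
    (\int[P]_w X w - x) * derive1 f x
      + \int[nu]_u ((derive1 f (x + u) - derive1 f x) * u)
    = h x - \int[P]_w h (X w).
Proof.
move=> f x; have [K K0 decay] := smooth_compact_decay hh.
have ch : continuous h := smooth_compact_continuous (n := 0) hh.
have [N _ hN] := smooth_compact_vanish hh.
have ih := L1_compact ch (hN 0%N).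
have [levy _] := hID.
exact: (stein_equation hID hX hsd ch hh0 ih K0 decay (levy_sigma_finite levy)).
Qed.
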